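(* Let $(X,\mu)$ be an infinite standard probability space, and let $w:X\times X\to[0,1]$ be a graphon. Let $\{\mu_j\}_{j\in\mathbb{Z}^*}$ be the distinct nonzero eigenvalues of $T_w$ (padded with zeros), with associated index sets $I_{\mu_j}$ as defined in the context (these index sets are determined by $w$). Let $\{(w_n,f_n)\}_{n\in\mathbb{N}}$ be a sequence of graphon signals, all represented on $X$, converging in norm to a graphon signal $(w,f)$. Then, for every nonzero $\mu_j$, $$P^{w_n}_{I_{\mu_j}}\to P^{w}_{I_{\mu_j}}\quad\text{in Hilbert--Schmidt norm as } n\to\infty.$$ In particular, for every nonzero $\mu_j$, $$P^{w_n}_{I_{\mu_j}}(f_n)\to P^{w}_{I_{\mu_j}}(f)\quad\text{in } L^2(X)\text{ as } n\to\infty.$$ Moreover, if $P^w_0(f)=\mathbf{0}$ (the zero function), then $$\sum_{j\in\mathbb{Z}^*}\big\|P^{w_n}_{I_{\mu_j}}(f_n)-P^{w}_{I_{\mu_j}}(f)\big\|_2^2\to 0\quad\text{as } n\to\infty.$$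
   Context: A standard probability space is the completion of a Borel probability space that is isomorphic (up to null sets) to the disjoint union of a closed interval (with Lebesgue measure) and a countable set of atoms. $L^2(X)$ denotes the complex Hilbert space of square-integrable functions on $X$, and $\mathbb{Z}^*=\mathbb{Z}\setminus\{0\}$. A graphon represented on $X$ is a measurable function $w:X\times X\to[0,1]$ with $w(x,y)=w(y,x)$ almost everywhere. A graphon signal is a pair $(w,f)$ with $w$ a graphon on $X$ and $f\in L^2(X)$. The cut norm is $\|u\|_\Box=\sup_{S,T\subseteq X}\left|\int_{S\times T}u\,d(\mu\times\mu)\right|$, the supremum being over measurable sets. A sequence $(w_n,f_n)$ of graphon signals on $X$ converges in norm to $(w,f)$ if $\|w_n-w\|_\Box\to0$ and $\|f_n-f\|_2\to0$. For a graphon $w$, $T_w:L^2(X)\to L^2(X)$ is the self-adjoint Hilbert--Schmidt operator $T_w(\xi)(x)=\int_X w(x,y)\xi(y)\,d\mu(y)$. Its nonzero eigenvalues, repeated according to multiplicity, are indexed by elements of $\mathbb{Z}^*$ as $$1\ge\lambda_1(w)\ge\lambda_2(w)\ge\dots\ge0\ge\dots\ge\lambda_{-2}(w)\ge\lambda_{-1}(w)\ge-1,$$ i.e. positive eigenvalues in decreasing order get indices $1,2,\dots$ and negative eigenvalues in increasing order get indices $-1,-2,\dots$; if there are only finitely many positive (respectively negative) eigenvalues, the corresponding sequence is padded with zeros. Let $I_w=\{i\in\mathbb{Z}^*:\lambda_i(w)\neq0\}$ and fix an orthonormal set $\{\phi_i\}_{i\in I_w}$ of eigenvectors, $T_w\phi_i=\lambda_i(w)\phi_i$,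 so $T_w=\sum_{i\in I_w}\lambda_i(w)\,\phi_i\otimes\phi_i$, where $(\phi\otimes\phi)(\xi)=\langle\xi,\phi\rangle\phi$. Let $\{\mu_j\}_{j\in\mathbb{Z}^*}$ be the sequence of distinct nonzero eigenvalues of $T_w$, ordered in the same way and padded with zeros. Put $I_{\mu_j}=\{i\in I_w:\lambda_i(w)=\mu_j\}$; thus $I_{\mu_j}=\emptyset$ if $\mu_j=0$. For any graphon $u$ on $X$, with its own ordered nonzero eigenvalues $\{\lambda_i(u)\}_{i\in I_u}$ and an orthonormal set of corresponding eigenvectors $\{\phi^u_i\}_{i\in I_u}$, and for a set of indices $I\subseteq\mathbb{Z}^*$, $P^u_I=\sum_{i\in I\cap I_u}\phi^u_i\otimes\phi^u_i$ (the zero operator if there are no terms). In particular $P^{w_n}_{I_{\mu_j}}$ uses the index set $I_{\mu_j}$ of $w$ together with the eigenvectors of $w_n$. $P^w_0$ is the orthogonal projection onto the null space of $T_w$. *)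

(* Defs.v *)
From HB Require Import structures.
From mathcomp Require Import all_boot all_order all_algebra.
From mathcomp Require Import complex.
From mathcomp Require Import all_classical all_reals all_analysis.

Set Implicit Arguments.
Unset Strict Implicit.
Unset Printing Implicit Defensive.

Import Order.TTheory GRing.Theory Num.Theory.
Import numFieldNormedType.Exports.

Local Open Scope classical_set_scope.
Local Open Scope ring_scope.

Section StandardProbability.
Context {R : realType} {d : measure_display} {X : measurableType d}.
Implicit Type mu : probability X R.

Definition is_completion mu (B : set (set X)) : Prop :=
  sigma_algebra setT B /\
  forall A : set X, measurable A <->
    exists B1 B2 : set X,
      [/\ B B1, B B2, B1 `<=` A, A `<=` B2 & mu (B2 `\` B1) = 0%E].

(* The disjoint union of the closed interval [0, c] with Lebesgue measure and
   of countably many atoms, realized as a measure on the Borel line: the k-th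
   atom has mass [p k] and is put at -(k + 1).  The rest of the line is null;
   an unused atom has mass 0, and there is no continuous part when c = 0. *)
Definition interval_atoms (c : R) (p : nat -> R) (A : set R) : \bar R :=
  (lebesgue_measure (A `&` [set x : R | (0 <= x <= c)%R]) +
   \sum_(0 <= k <oo) (p k)%:E * \d_((- k.+1%:R)%R : R) A)%E.

(* A measure-preserving isomorphism, after removal of null sets, from
   (X, B, mu) to the Borel line equipped with [nu]. *)
Definition isomorphic_mod0 mu (B : set (set X)) (nu : set R -> \bar R) : Prop :=
  exists (X0 : set X) (Y0 : set R) (g : X -> R),
    [/\ B X0, measurable Y0, mu (~` X0) = 0%E & nu (~` Y0) = 0%E] /\
    [/\ set_bij X0 Y0 g,
        forall C : set R, measurable C -> B (X0 `&` g @^-1` C),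
        forall A : set X, B A -> A `<=` X0 -> measurable (g @` A) &
        forall C : set R, measurable C -> mu (X0 `&` g @^-1` C) = nu C].

Definition standard_probability mu : Prop :=
  exists B : set (set X), is_completion mu B /\
  exists (c : R) (p : nat -> R),
    [/\ 0 <= c, forall k, 0 <= p k & isomorphic_mod0 mu B (interval_atoms c p)].

End StandardProbability.

(* Elements of L^2(X) are represented by functions; equality in L^2(X) is
   equality almost everywhere. *)
Section L2.
Context {R : realType} {d : measure_display} {X : measurableType d}.
Variable mu : probability X R.
Implicit Types xi eta : X -> R[i].

Definition cintegral xi : R[i] :=
  Complex (\int[mu]_x complex.Re (xi x)) (\int[mu]_x complex.Im (xi x)).

Definition L2norm xi : \bar R :=
  Lnorm mu 2%:E (fun x => (ComplexField.Normc.normc (xi x))%:E).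

Definition inL2 xi : Prop :=
  [/\ measurable_fun setT (fun x => complex.Re (xi x)),
      measurable_fun setT (fun x => complex.Im (xi x)) &
      (L2norm xi < +oo)%E].

Definition inner xi eta : R[i] := cintegral (fun x => xi x * conjc (eta x)).

Definition orthonormal (I : eqType) (D : set I) (e : I -> X -> R[i]) : Prop :=
  (forall i, D i -> inL2 (e i)) /\
  (forall i j, D i -> D j -> inner (e i) (e j) = (i == j)%:R).

Definition is_orth_proj (N : set (X -> R[i])) (f g : X -> R[i]) : Prop :=
  N g /\ forall h, N h -> inner (f \- g) h = 0.

(* The squared Hilbert-Schmidt norm of T is the sum of |T e|^2 over an
   orthonormal basis, which does not depend on the basis.  Every finite
   orthonormal family extends to a basis, so this sum is the supremum of the
   finite sums below; this form does not require choosing a basis.  Lemma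
   [hs_norm_basis] is the inequality by which convergence to 0 for [hs_norm]
   implies it for the sum over any given basis. *)
Definition hs_norm (T : (X -> R[i]) -> X -> R[i]) : \bar R :=
  sqrte (ereal_sup [set s | exists (n : nat) (e : nat -> X -> R[i]),
    orthonormal `I_n e /\ s = (\sum_(k < n) L2norm (T (e k)) ^+ 2)%E]).

Lemma hs_norm_basis T (e : nat -> X -> R[i]) :
  orthonormal setT e ->
  (sqrte (\sum_(0 <= k <oo) L2norm (T (e k)) ^+ 2) <= hs_norm T)%E.
Proof.
move=> [e2 eo].
have pos k : (0 <= L2norm (T (e k)) ^+ 2)%E by exact: sqre_ge0.
have eI n : orthonormal `I_n e.
  by split=> [i _|i j _ _]; [exact: e2|exact: eo].
have sup0 : (0 <= ereal_sup [set s | exists (n : nat) (e : nat -> X -> R[i]),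
    orthonormal `I_n e /\ s = (\sum_(k < n) L2norm (T (e k)) ^+ 2)%E])%E.
  by apply: ereal_sup_ubound; exists 0%N, e; rewrite big_ord0.
rewrite /hs_norm (lee_sqrt _ sup0).
apply: lime_le; first by apply: is_cvg_nneseries.
apply: nearW => n; rewrite big_mkord; apply: ereal_sup_ubound.
by exists n, e.
Qed.

End L2.

Section Graphon.
Context {R : realType} {d : measure_display} {X : measurableType d}.
Variable mu : probability X R.

Definition graphon (w : X * X -> R) : Prop :=
  [/\ measurable_fun setT w, forall z, 0 <= w z <= 1 &
      {ae (mu \x mu)%E, forall z, w (z.1, z.2) = w (z.2, z.1)}].

Definition graphon_signal (w : X * X -> R) (f : X -> R[i]) : Prop :=
  graphon w /\ inL2 mu f.

Definition cut_norm (u : X * X -> R) : \bar R :=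
  ereal_sup [set r | exists S T : set X, [/\ measurable S, measurable T &
    r = `|\int[(mu \x mu)%E]_(z in S `*` T) u z|%:E]].

Definition cvg_in_norm (wn : nat -> X * X -> R) (fn : nat -> X -> R[i])
    (w : X * X -> R) (f : X -> R[i]) : Prop :=
  cut_norm (wn n \- w) @[n --> \oo] --> 0%E /\
  L2norm mu (fn n \- f) @[n --> \oo] --> 0%E.

Definition graphon_op (w : X * X -> R) (xi : X -> R[i]) : X -> R[i] :=
  fun x => cintegral mu (fun y => real_complex R (w (x, y)) * xi y).

Definition in_eigenspace (w : X * X -> R) (l : R) (xi : X -> R[i]) : Prop :=
  inL2 mu xi /\
  {ae mu, forall x, graphon_op w xi x = real_complex R l * xi x}.

(* Only real eigenvalues are considered: [graphon_op w] is self-adjoint. *)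
Definition eigenvalue (w : X * X -> R) (l : R) : Prop :=
  exists xi, in_eigenspace w l xi /\ ~ {ae mu, forall x, xi x = 0}.

Definition null_space (w : X * X -> R) : set (X -> R[i]) :=
  [set xi | inL2 mu xi /\ {ae mu, forall x, graphon_op w xi x = 0}].

End Graphon.

(* Families indexed by the nonzero integers are functions on [int] whose value
   at 0 is irrelevant: every definition below discards the index 0. *)
Section Spectrum.
Context {R : realType} {d : measure_display} {X : measurableType d}.
Variable mu : probability X R.

(* s_1 >= s_2 >= ... >= 0 >= ... >= s_(-2) >= s_(-1) *)
Definition spectrally_ordered (s : int -> R) : Prop :=
  [/\ forall i j, 0 < i -> i <= j -> s j <= s i,
      forall i j, i <= j -> j < 0 -> s j <= s i,
      forall i, 0 < i -> 0 <= s i &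
      forall i, i < 0 -> s i <= 0].

Definition nonzero_indices (lam : int -> R) : set int :=
  [set i | i != 0 /\ lam i != 0].

(* [lam] lists the nonzero eigenvalues of the operator of [w] repeated
   according to multiplicity and padded with zeros, and [phi] is an
   orthonormal set of corresponding eigenvectors.  The last clause says that
   the [phi i] with [lam i = l] span the eigenspace of [l], hence (being
   orthonormal) form a basis of it: [l] is listed as many times as the
   dimension of its eigenspace. *)
Definition eigensystem (w : X * X -> R) (lam : int -> R)
    (phi : int -> X -> R[i]) : Prop :=
  [/\ spectrally_ordered lam,
      orthonormal mu (nonzero_indices lam) phi,
      forall i, nonzero_indices lam i -> in_eigenspace mu w (lam i) (phi i) &
      forall (l : R) (xi : X -> R[i]), l != 0 -> in_eigenspace mu w l xi ->
        exists (s : seq int) (a : int -> R[i]),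
          (forall i, i \in s -> i != 0 /\ lam i = l) /\
          {ae mu, forall x, xi x = \sum_(i <- s) a i * phi i x}].

Definition distinct_eigenvalues (w : X * X -> R) (m : int -> R) : Prop :=
  [/\ spectrally_ordered m,
      forall i j, nonzero_indices m i -> nonzero_indices m j ->
        m i = m j -> i = j,
      forall i, nonzero_indices m i -> eigenvalue mu w (m i) &
      forall l, l != 0 -> eigenvalue mu w l -> exists i, i != 0 /\ m i = l].

Definition eigen_indices (lam : int -> R) (l : R) : set int :=
  [set i | nonzero_indices lam i /\ lam i = l].

(* The sum is a finite one: it is used only for [I] the index set of an
   eigenvalue, which is finite since nonzero eigenvalues of a Hilbert-Schmidt
   operator have finite multiplicity. *)
Definition spectral_proj (lam : int -> R) (phi : int -> X -> R[i])
    (I : set int) (xi : X -> R[i]) : X -> R[i] :=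
  fun x => \sum_(i \in I `&` nonzero_indices lam) (inner mu xi (phi i) * phi i x).

End Spectrum.

(* Main.v *)
(* A complex L^2 space is treated as a real Hilbert space, each eigenvector phi
   contributing the orthonormal pair phi, i phi.  Cut norm convergence makes the
   quadratic forms of the operators of w_n converge, uniformly on the unit ball,
   to that of w.  By Ky Fan's principle the sum of the first k eigenvalues is the
   maximum of the trace of the form over orthonormal k-families; when there is
   a gap after the k-th eigenvalue of w, an almost maximal family is close to the
   span of the first k eigenvectors, so the projections on the first k
   eigenvectors converge in Hilbert-Schmidt norm.  The projection for one
   eigenvalue is a difference of two such projections, and negative eigenvalues
   are those of the opposite operator.  The last claim follows by cutting the
   tails of the sum with Bessel's inequality for w_n and Parseval's identity
   for f. *)

Require Import Defs.
From HB Require Import structures.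
From mathcomp Require Import all_boot all_order all_algebra.
From mathcomp Require Import complex ring lra.
From mathcomp Require Import all_classical all_reals all_analysis.
From mathcomp Require Import measurable_realfun.

Import Order.TTheory GRing.Theory Num.Theory.
Import numFieldNormedType.Exports.

Local Open Scope classical_set_scope.
Local Open Scope ring_scope.

Set Implicit Arguments.
Unset Strict Implicit.
Unset Printing Implicit Defensive.

(** Vectors are functions, not classes modulo null sets, so the inner product is only positive
    semidefinite: equations between vectors, the eigenvalue equation included, are read as a
    vanishing squared norm [nsq]. Ky Fan's bound requires the form to be at most the (k+1)-st
    eigenvalue on the complement of the first k eigenvectors. This rests on the existence of
    eigenvectors, drawn from completeness and the Hilbert-Schmidt bound through a Fredholm
    alternative on closed subspaces. Two obstacles shape the comparison of w_n with w. The index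
    sets come from w, so w_n may have fewer nonzero eigenvalues at these places and the two families
    may differ in size. Eigenvectors inside a multiple eigenvalue are arbitrary, so only the total
    overlap, the sum of the squares of all <e_i, q_j>, can be controlled. The cut norm reaches the
    forms through a fourth power: a kernel K bounded by 1 maps L^2 into bounded functions and, by
    duality, bounded functions to functions of small L^1 norm, so K K f is small in L^2. *)

Record semi_inner (R : realType) (V : lmodType R) := SemiInner {
  ip :> V -> V -> R;
  ipC : forall x y, ip x y = ip y x;
  ipDl : forall x y z, ip (x + y) z = ip x z + ip y z;
  ipZl : forall a x y, ip (a *: x) y = a * ip x y;
  ip_ge0 : forall x, 0 <= ip x x }.

(** * Semi-inner products, finite orthonormal families and closed subspaces *)

Section SemiInner.
Context {R : realType} {V : lmodType R} (ip : semi_inner V).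
Implicit Types (x y z : V) (a : R).

Definition nsq x : R := ip x x.

Lemma nsq_ge0 x : 0 <= nsq x. Proof. exact: ip_ge0. Qed.

Lemma ipDr x y z : ip x (y + z) = ip x y + ip x z.
Proof. by rewrite ipC ipDl !(ipC _ x). Qed.

Lemma ipZr a x y : ip x (a *: y) = a * ip x y.
Proof. by rewrite ipC ipZl ipC. Qed.

Lemma ip0l x : ip 0 x = 0.
Proof. by rewrite -(scale0r 0) ipZl mul0r. Qed.

Lemma ipNl x y : ip (- x) y = - ip x y.
Proof. by rewrite -scaleN1r ipZl mulN1r. Qed.

Lemma ipNr x y : ip x (- y) = - ip x y.
Proof. by rewrite ipC ipNl ipC. Qed.

Lemma ipBl x y z : ip (x - y) z = ip x z - ip y z.
Proof. by rewrite ipDl ipNl. Qed.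

Lemma ipBr x y z : ip x (y - z) = ip x y - ip x z.
Proof. by rewrite ipDr ipNr. Qed.

Lemma ip_suml (I : Type) (s : seq I) (P : pred I) (F : I -> V) x :
  ip (\sum_(i <- s | P i) F i) x = \sum_(i <- s | P i) ip (F i) x.
Proof. by elim/big_ind2: _ => [|u a v b <- <-|//]; rewrite ?ip0l ?ipDl. Qed.

Lemma ip_sumr (I : Type) (s : seq I) (P : pred I) (F : I -> V) x :
  ip x (\sum_(i <- s | P i) F i) = \sum_(i <- s | P i) ip x (F i).
Proof. by rewrite ipC ip_suml; apply: eq_bigr => i _; rewrite ipC. Qed.

Lemma nsq0 : nsq 0 = 0. Proof. exact: ip0l. Qed.

Lemma nsqN x : nsq (- x) = nsq x.
Proof. by rewrite /nsq ipNl ipNr opprK. Qed.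

Lemma nsqBC x y : nsq (x - y) = nsq (y - x).
Proof. by rewrite -nsqN opprB. Qed.

Lemma nsqZ a x : nsq (a *: x) = a ^+ 2 * nsq x.
Proof. by rewrite /nsq ipZl ipZr mulrA expr2. Qed.

Lemma nsqD x y : nsq (x + y) = nsq x + 2 * ip x y + nsq y.
Proof. by rewrite /nsq !ipDl !ipDr (ipC _ y x); ring. Qed.

Lemma nsqB x y : nsq (x - y) = nsq x - 2 * ip x y + nsq y.
Proof. by rewrite nsqD nsqN ipNr; ring. Qed.

Lemma nsqD_le x y : nsq (x + y) <= 2 * nsq x + 2 * nsq y.
Proof. by have := nsq_ge0 (x - y); rewrite nsqB nsqD; lra. Qed.

Lemma nsqB_le x y : nsq (x - y) <= 2 * nsq x + 2 * nsq y.
Proof. by have := nsqD_le x (- y); rewrite nsqN. Qed.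

Lemma cauchy_schwarz x y : ip x y ^+ 2 <= nsq x * nsq y.
Proof.
have [y0|yn0] := eqVneq (nsq y) 0; last first.
  have yp : 0 < nsq y by rewrite lt_neqAle eq_sym yn0 nsq_ge0.
  have := nsq_ge0 (nsq y *: x - ip x y *: y).
  rewrite nsqB !nsqZ ipZl ipZr => h.
  rewrite -subr_ge0 -(pmulr_rge0 _ yp); apply: le_trans h _.
  by rewrite le_eqVlt; apply/orP; left; apply/eqP; ring.
(* For a null [y], [nsq x - 2 t <x, y>] is nonnegative for every [t], which forces [<x, y> = 0]. *)
have h t : 2 * t * ip x y <= nsq x.
  have := nsq_ge0 (x - t *: y); by rewrite nsqB nsqZ y0 ipZr mulr0 addr0 mulrA subr_ge0.
suff -> : ip x y = 0 by rewrite expr0n mulr_ge0 ?nsq_ge0.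
apply/eqP/negP => /negP ip0.
have := h ((nsq x + 1) / (2 * ip x y)).
have -> : 2 * ((nsq x + 1) / (2 * ip x y)) * ip x y = nsq x + 1 by field.
lra.
Qed.

Lemma ip_nsq0 x y : nsq x = 0 -> ip x y = 0.
Proof.
move=> x0; have := cauchy_schwarz x y; rewrite x0 mul0r => h.
by apply/eqP; rewrite -sqrf_eq0 eq_le h sqr_ge0.
Qed.

Lemma ip_le x y : 2 * `|ip x y| <= nsq x + nsq y.
Proof.
have := nsq_ge0 (x - y); have := nsq_ge0 (x + y); rewrite nsqD nsqB.
move=> h1 h2; have [h|h] := leP 0 (ip x y); first by rewrite ger0_norm //; lra.
by rewrite ltr0_norm //; lra.
Qed.

Definition onf {I : eqType} (s : seq I) (e : I -> V) :=
  uniq s /\ {in s &, forall i j, ip (e i) (e j) = (i == j)%:R}.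

Definition orth_proj {I : eqType} (s : seq I) (e : I -> V) x :=
  \sum_(i <- s) ip x (e i) *: e i.

Section Families.
Context {I : eqType} (s : seq I) (e : I -> V).

Lemma onf_sum (F : I -> R) j : onf s e -> j \in s ->
  \sum_(i <- s) F i * ip (e i) (e j) = F j.
Proof.
move=> [us oe] js; rewrite (bigD1_seq j) //= oe // eqxx mulr1 big1_seq ?addr0//.
by move=> i /andP[ij si]; rewrite oe // (negbTE ij) mulr0.
Qed.

Hypothesis oe : onf s e.

Lemma ip_proj x y : ip (orth_proj s e x) y = \sum_(i <- s) ip x (e i) * ip y (e i).
Proof. by rewrite ip_suml; apply: eq_bigr => i _; rewrite ipZl (ipC _ y). Qed.

Lemma ip_proj_in x j : j \in s -> ip (orth_proj s e x) (e j) = ip x (e j).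
Proof.
move=> js; rewrite ip_suml; under eq_bigr do rewrite ipZl.
exact: (onf_sum (fun i => ip x (e i))).
Qed.

Lemma ip_resid x j : j \in s -> ip (x - orth_proj s e x) (e j) = 0.
Proof. by move=> js; rewrite ipBl ip_proj_in ?subrr. Qed.

Lemma nsq_proj x : nsq (orth_proj s e x) = \sum_(i <- s) ip x (e i) ^+ 2.
Proof.
rewrite /nsq ip_proj; apply: eq_big_seq => i si.
by rewrite ip_proj_in // expr2.
Qed.

Lemma nsq_resid x : nsq (x - orth_proj s e x) = nsq x - \sum_(i <- s) ip x (e i) ^+ 2.
Proof.
rewrite nsqB nsq_proj ipC ip_proj.
under [X in _ - 2 * X + _]eq_bigr do rewrite -expr2.
by ring.
Qed.

Lemma bessel x : \sum_(i <- s) ip x (e i) ^+ 2 <= nsq x.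
Proof. by rewrite -subr_ge0 -nsq_resid nsq_ge0. Qed.

End Families.

Definition tends (u : nat -> V) x :=
  forall eps, 0 < eps -> exists N, forall n, (N <= n)%N -> nsq (u n - x) < eps.

Definition complete := forall u : nat -> V,
  (forall eps, 0 < eps -> exists N, forall m n, (N <= m)%N -> (N <= n)%N ->
     nsq (u m - u n) < eps) ->
  exists x, tends u x.

Definition closed_subspace (W : V -> Prop) :=
  [/\ W 0, forall a x y, W x -> W y -> W (a *: x + y) &
      forall u x, (forall n, W (u n)) -> tends u x -> W x].

Lemma tends_ip u x y c : tends u x -> (forall n, ip (u n) y = c) -> ip x y = c.
Proof.
move=> ux uy; apply/eqP; rewrite -subr_eq0 -sqrf_eq0; apply/negP => /negP h.
have hp : 0 < (ip x y - c) ^+ 2 by rewrite lt_neqAle eq_sym h sqr_ge0.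
have yp : 0 < nsq y + 1 by have := nsq_ge0 y; lra.
have [N hN] := ux _ (divr_gt0 hp yp).
have := hN N (leqnn _); rewrite ltr_pdivlMr // => h1.
have := cauchy_schwarz (u N - x) y.
rewrite ipBl uy -sqrrN opprB.
have := nsq_ge0 (u N - x); nra.
Qed.

Lemma closed_subspace_perp (D : V -> Prop) :
  closed_subspace (fun x => forall y, D y -> ip x y = 0).
Proof.
split=> [y _|a x y hx hy z Dz|u x hu ux y Dy]; first exact: ip0l.
  by rewrite ipDl ipZl hx // hy // mulr0 addr0.
by apply: (tends_ip ux) => n; exact: hu.
Qed.

Lemma closed_subspaceI W1 W2 : closed_subspace W1 -> closed_subspace W2 ->
  closed_subspace (fun x => W1 x /\ W2 x).
Proof.
move=> [a0 aD aC] [b0 bD bC]; split=> [//|a x y [? ?] [? ?]|u x h ux].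
  by split; [exact: aD|exact: bD].
by split; [apply: (aC u)|apply: (bC u)] => // n; case: (h n).
Qed.

End SemiInner.

Arguments nsq {R V} ip x.

(** * Eigenvectors of Hilbert-Schmidt operators *)

Section Fredholm.
Context {R : realType} {V : lmodType R} (ip : semi_inner V).
Hypothesis V_complete : complete ip.
Local Notation nsq := (nsq ip).

Section BoundedOperator.
Context (N : V -> V) (C : R).
Hypotheses (N_lin : linear N) (N_bound : forall x, nsq (N x) <= C * nsq x).

Let NZ a x : N (a *: x) = a *: N x.
Proof.
have N0 : N 0 = 0 by have := N_lin (-1) 0 0; rewrite scaler0 addr0 scaleN1r addNr.
by have := N_lin a x 0; rewrite N0 !addr0.
Qed.

Let NB x y : N (x - y) = N x - N y.
Proof. by rewrite addrC -scaleN1r N_lin scaleN1r addrC. Qed.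

Lemma tends_bounded u x : tends ip u x ->
  (forall n, nsq (N (u n)) <= n.+1%:R^-1) -> nsq (N x) = 0.
Proof.
move=> ux uN; apply/eqP; rewrite eq_le nsq_ge0 andbT leNgt; apply/negP => Nx.
pose C' := Num.max C 1.
have C'1 : 1 <= C' by rewrite le_max lexx orbT.
(* The 8 leaves room in [nsq (N x) <= 2 nsq (N v) + 2 nsq (N (v - x))]: each term on the right stays
   below a quarter of [nsq (N x)]. *)
have e0 : 0 < nsq (N x) / (8 * C') by apply: divr_gt0 => //; lra.
have [n hn] := ux _ e0.
have e1 : 0 < nsq (N x) / 8 by lra.
have [k _ /= hk] := near_infty_natSinv_lt (PosNum e1).
have := hn (maxn n k) (leq_maxl _ _); have := hk (maxn n k) (leq_maxr _ _).
move: (uN (maxn n k)); set v := u _; move=> h1 h2.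
rewrite ltr_pdivlMr => [h3|]; last by lra.
have hC : nsq (N (v - x)) <= C' * nsq (v - x).
  by apply: le_trans (N_bound _) _; rewrite ler_wpM2r ?nsq_ge0 // le_max lexx.
have := nsqB_le ip (N v) (N v - N x).
rewrite opprB addrC subrK -NB.
move=> h4; have := le_lt_trans h1 h2; move: (nsq_ge0 ip x) hC h3 h4 Nx; clear; clearbody C'; lra.
Qed.

(* Vectors z of W with <z, f> = 1 and N z small form a Cauchy family, since N is
   bounded below on their differences; the limit is the kernel vector. *)
Lemma bounded_below_step (W : V -> Prop) f delta : closed_subspace ip W ->
  0 < delta ->
  (forall x, W x -> ip x f = 0 -> delta * nsq x <= nsq (N x)) ->
  (exists2 delta', 0 < delta' & forall x, W x -> delta' * nsq x <= nsq (N x)) \/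
  exists z, [/\ W z, 0 < nsq z & nsq (N z) = 0].
Proof.
move=> [W0 WD WC] delta0 hf.
have WZ a x : W x -> W (a *: x) by move=> Wx; rewrite -[_ *: _]addr0; exact: WD.
have WB x y : W x -> W y -> W (x - y).
  by move=> Wx Wy; rewrite addrC -scaleN1r; exact: WD.
have [[x0 Wx0 x0f]|no] := pselect (exists2 x0, W x0 & ip x0 f != 0); last first.
  left; exists delta => // x Wx; apply: hf => //; apply/eqP/negP => /negP xf.
  by apply: no; exists x.
apply: contrapT => /not_orP[nb nk].
apply: nk.
pose x1 := (ip x0 f)^-1 *: x0.
have Wx1 : W x1 by exact: WZ.
have x1f : ip x1 f = 1 by rewrite ipZl mulVf.
clearbody x1.
(* If [N] almost kills [x], then [x - a x1] with [a = <x, f>] lies in the part of [W] where [N] is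
   bounded below, and solving the resulting inequality gives [nsq x <= 2 K a^2]. Hence [a] is
   nonzero, and [x / a] pairs to 1 with [f] while [N] stays small on it. *)
pose K := 4 * nsq (N x1) / delta + 2 * nsq x1.
have K0 : 0 <= K.
  by rewrite addr_ge0 ?mulr_ge0 ?nsq_ge0 ?invr_ge0 // ltW.
have claim eta : 0 < eta -> exists z, [/\ W z, ip z f = 1 & nsq (N z) <= eta].
  move=> eta0.
  pose e := Num.min (delta / 8) (eta / (2 * K + 1)).
  have e0 : 0 < e by rewrite lt_min !divr_gt0 //; lra.
  have [x [Wx xe]] : exists x, W x /\ nsq (N x) < e * nsq x.
    apply: contrapT => no; apply: nb; exists e => // x Wx.
    by rewrite leNgt; apply/negP => h; apply: no; exists x.
  pose a := ip x f.
  have xp : 0 < nsq x.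
    by rewrite -(pmulr_rgt0 _ e0); apply: le_lt_trans xe; exact: nsq_ge0.
  have hy : delta * nsq (x - a *: x1) <= 2 * nsq (N x) + 2 * (a ^+ 2 * nsq (N x1)).
    have -> : a ^+ 2 * nsq (N x1) = nsq (N (a *: x1)) by rewrite (NZ a) nsqZ.
    apply: le_trans (nsqB_le ip _ _); rewrite -NB; apply: hf.
      by apply: WB => //; exact: WZ.
    by rewrite ipBl ipZl x1f mulr1 subrr.
  have hx : nsq x <= 2 * nsq (x - a *: x1) + 2 * (a ^+ 2 * nsq x1).
    by rewrite -nsqZ; apply: le_trans (nsqD_le ip _ _); rewrite subrK.
  have hd : nsq (N x) <= delta / 8 * nsq x.
    by apply: (le_trans (ltW xe)); rewrite ler_wpM2r ?nsq_ge0 // ge_min lexx.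
  have he : nsq (N x) <= eta / (2 * K + 1) * nsq x.
    by apply: (le_trans (ltW xe)); rewrite ler_wpM2r ?nsq_ge0 // ge_min lexx orbT.
  have hK : nsq x <= 2 * K * a ^+ 2.
    have : delta * nsq x <= 4 * nsq (N x) + 4 * (a ^+ 2 * nsq (N x1))
              + 2 * (a ^+ 2 * nsq x1) * delta.
      have := ler_wpM2l (ltW delta0) hx; lra.
    have -> : 2 * K * a ^+ 2 = (8 * nsq (N x1) + 4 * nsq x1 * delta) * a ^+ 2 / delta.
      by rewrite /K; field; rewrite gt_eqF.
    rewrite ler_pdivlMr //; lra.
  have a0 : a != 0.
    by apply/eqP => a0; move: hK; rewrite a0 expr0n mulr0 leNgt xp.
  exists (a^-1 *: x); split; first exact: WZ.
    by rewrite ipZl mulVf.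
  rewrite NZ nsqZ exprVn mulrC ler_pdivrMr ?exprn_even_gt0 //.
  apply: (le_trans he); rewrite mulrAC ler_pdivrMr; last by lra.
  have := sqr_ge0 a; have := ler_wpM2l (ltW eta0) hK; nra.
have /choice[z hz] n : exists z, [/\ W z, ip z f = 1 & nsq (N z) <= n.+1%:R^-1].
  by apply: claim; rewrite invr_gt0.
have [x zx] : exists x, tends ip z x.
  apply: V_complete => eps eps0.
  have e1 : 0 < delta * eps / 4 by rewrite divr_gt0 ?mulr_gt0.
  have [k _ /= hk] := near_infty_natSinv_lt (PosNum e1).
  exists k => m n km kn.
  have [Wm fm Nm] := hz m; have [Wn fn Nn] := hz n.
  have := hf (z m - z n) (WB _ _ Wm Wn).
  rewrite ipBl fm fn subrr NB => /(_ erefl) h.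
  have := nsqB_le ip (N (z m)) (N (z n)).
  have := le_lt_trans Nm (hk m km); have := le_lt_trans Nn (hk n kn) => /= h1 h2 h3.
  have : delta * nsq (z m - z n) < delta * eps by lra.
  by rewrite ltr_pM2l.
exists x; split.
- by apply: (WC z) => // n; case: (hz n).
- have xf : ip x f = 1 by apply: (tends_ip zx) => n; case: (hz n).
  rewrite lt_neqAle nsq_ge0 andbT eq_sym; apply/eqP => x00.
  by have := ip_nsq0 f x00; rewrite xf => /eqP; rewrite oner_eq0.
- by apply: (tends_bounded zx) => n; case: (hz n).
Qed.

(** The finitely many constraints are lifted one at a time: the induction hypothesis applies to the
    orthogonal complement of [f] in [W], and [bounded_below_step] then removes [f]. *)
Lemma bounded_below_or_kernel (fs : seq V) (W : V -> Prop) delta :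
  closed_subspace ip W -> 0 < delta ->
  (forall x, W x -> {in fs, forall f, ip x f = 0} -> delta * nsq x <= nsq (N x)) ->
  (exists2 delta', 0 < delta' & forall x, W x -> delta' * nsq x <= nsq (N x)) \/
  exists z, [/\ W z, 0 < nsq z & nsq (N z) = 0].
Proof.
elim: fs W delta => [|f fs IH] W delta cW delta0 h.
  by left; exists delta => // x Wx; apply: h.
pose W1 x := W x /\ forall y, y = f -> ip x y = 0.
have cW1 : closed_subspace ip W1.
  by apply: closed_subspaceI => //; exact: closed_subspace_perp.
have [|[d1 d10 hd1]|[z [[Wz _] z0 Nz]]] := IH W1 delta cW1 delta0.
- move=> x [Wx xf] hx; apply: h => // g; rewrite inE => /orP[/eqP ->|]; last exact: hx.
  exact: xf.
- apply: (bounded_below_step cW d10 (f := f)) => x Wx xf; apply: hd1.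
  by split=> // y ->.
- by right; exists z.
Qed.

End BoundedOperator.

Section Operator.
Context (T : V -> V) (B : R).

Definition symmetric := forall x y, ip (T x) y = ip x (T y).

Definition hilbert_schmidt := forall (m : nat) (e : nat -> V),
  onf ip (iota 0 m) e -> \sum_(i <- iota 0 m) nsq (T (e i)) <= B.

Hypotheses (T_lin : linear T) (T_sym : symmetric) (T_hs : hilbert_schmidt).

Let TZ a x : T (a *: x) = a *: T x.
Proof.
have T0 : T 0 = 0 by have := T_lin (-1) 0 0; rewrite scaler0 addr0 scaleN1r addNr.
by have := T_lin a x 0; rewrite T0 !addr0.
Qed.

Lemma onf_normalize x : 0 < nsq x -> nsq ((Num.sqrt (nsq x))^-1 *: x) = 1.
Proof.
by move=> x0; rewrite nsqZ exprVn sqr_sqrtr ?(ltW x0) // mulVf // gt_eqF.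
Qed.

Lemma hs_bounded x : nsq (T x) <= B * nsq x.
Proof.
have [x0|xn0] := eqVneq (nsq x) 0.
  (* A null [x] has a null image, since [nsq (T x) = <x, T (T x)>]. *)
  by rewrite x0 mulr0 /nsq T_sym ip_nsq0.
have xp : 0 < nsq x by rewrite lt_neqAle eq_sym xn0 nsq_ge0.
have := @T_hs 1 (fun _ => (Num.sqrt (nsq x))^-1 *: x).
rewrite big_cons big_nil addr0 TZ nsqZ exprVn sqr_sqrtr ?(ltW xp) //.
rewrite mulrC ler_pdivrMr //; apply; split => // i j.
by rewrite !inE => /eqP -> /eqP ->; rewrite -/(nsq _) onf_normalize.
Qed.

(* Otherwise orthonormal families of any length with c < nsq (T e_i) could be
   built greedily. *)
Lemma hs_finite_codim c : 0 < c -> exists fs : seq V,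
  forall x, {in fs, forall f, ip x f = 0} -> nsq (T x) <= c * nsq x.
Proof.
move=> c0; apply: contrapT => no.
have ex m : exists e : nat -> V, onf ip (iota 0 m) e /\
    forall i, (i < m)%N -> c <= nsq (T (e i)).
  elim: m => [|m [e [[_ oe] he]]]; first by exists (fun=> 0); split=> //; split.
  have [x [hx Tx]] : exists x, {in [seq e i | i <- iota 0 m], forall f, ip x f = 0} /\
      c * nsq x < nsq (T x).
    apply: contrapT => no'; apply: no; exists [seq e i | i <- iota 0 m] => x hx.
    by rewrite leNgt; apply/negP => h; apply: no'; exists x.
  have xp : 0 < nsq x.
    rewrite lt_neqAle nsq_ge0 andbT eq_sym; apply/eqP => x0.
    by move: Tx; have := hs_bounded x; rewrite x0 !mulr0 => h; rewrite ltNge h.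
  pose x' := (Num.sqrt (nsq x))^-1 *: x.
  have x'e i : (i < m)%N -> ip x' (e i) = 0.
    by move=> im; rewrite ipZl hx ?mulr0 //; apply: map_f; rewrite mem_iota.
  exists (fun i => if (i < m)%N then e i else x'); split; last first.
    move=> i _; case: ifP => [/he //|_].
    rewrite TZ nsqZ exprVn sqr_sqrtr ?(ltW xp) // mulrC ler_pdivlMr //.
    exact: ltW.
  split=> [|i j]; first exact: iota_uniq.
  rewrite !mem_iota !add0n !ltnS => /andP[_ im] /andP[_ jm].
  case: ltnP => i1; case: ltnP => j1.
  - by apply: oe; rewrite mem_iota.
  - by rewrite ipC x'e // ltn_eqF // (leq_trans i1).
  - by rewrite x'e // eq_sym ltn_eqF // (leq_trans j1).
  - have -> : i = j by apply/eqP; rewrite eqn_leq (leq_trans im j1) (leq_trans jm i1).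
    by rewrite eqxx -/(nsq _) onf_normalize.
have [m hm] : exists m, B < m%:R * c.
  exists (Num.truncn (B / c)).+1; rewrite -ltr_pdivrMr //.
  exact: truncnS_gt.
have [e [oe he]] := ex m.
have := T_hs oe; apply/negP; rewrite -ltNge; apply: (lt_le_trans hm).
have -> : m%:R * c = \sum_(i <- iota 0 m) c.
  by rewrite big_const_seq count_predT size_iota iter_addr_0 mulr_natl.
rewrite big_seq [leRHS]big_seq; apply: ler_sum => i.
by rewrite mem_iota => /andP[_ im]; exact: he.
Qed.

Lemma hs_bound_ge0 : 0 <= B.
Proof. by have := @T_hs 0 (fun=> 0); rewrite big_nil; apply; split. Qed.

(** On the complement of finitely many vectors [nsq (T x)] is at most [l^2/4 * nsq x], and [l^2 nsq
    x <= 2 nsq (T x) + 2 nsq (T x - l x)] makes [T - l] bounded below there with the constant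
    [l^2/4]. The finite codimension is absorbed by [bounded_below_or_kernel]. *)
Lemma fredholm_alternative l (W : V -> Prop) : closed_subspace ip W -> l != 0 ->
  (exists2 delta, 0 < delta &
     forall x, W x -> delta * nsq x <= nsq (T x - l *: x)) \/
  exists z, [/\ W z, 0 < nsq z & nsq (T z - l *: z) = 0].
Proof.
move=> cW l0.
have l2 : 0 < l ^+ 2 by rewrite exprn_even_gt0.
have c0 : 0 < l ^+ 2 / 4 by lra.
have [fs hfs] := hs_finite_codim c0.
pose N x := T x - l *: x.
have N_lin : linear N.
  move=> a x y; rewrite /N T_lin !scalerDr scalerN !scalerA (mulrC l) opprD.
  by rewrite !addrA; congr (_ - _); rewrite addrAC.
have d0 : 0 < l ^+ 2 / 4 by [].
apply: (@bounded_below_or_kernel N (2 * B + 2 * l ^+ 2) N_lin _ fs W (l ^+ 2 / 4)) => //.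
  move=> x; apply: le_trans (nsqB_le ip _ _) _; rewrite nsqZ.
  by have := hs_bounded x; lra.
move=> x _ /hfs hx.
have := nsqB_le ip (T x) (N x).
by rewrite /N opprB addrC subrK nsqZ; lra.
Qed.

Lemma ip_T_le x : ip (T x) x <= (B + 1) / 2 * nsq x.
Proof.
have := ip_le ip (T x) x; have := hs_bounded x; have := ler_norm (ip (T x) x).
by lra.
Qed.

(** [M] is the supremum of the Rayleigh quotient on [W]. Without an eigenvector for [M] in [W],
    [T - M] would be bounded below on [W] and the quotient would stay below [M] by a fixed amount.
    The vector [x0] forces [M > c >= 0], so the Fredholm alternative applies at [M]. *)
Lemma top_eigenvector (W : V -> Prop) c x0 : closed_subspace ip W ->
  (forall x, W x -> W (T x)) -> 0 <= c -> W x0 -> c * nsq x0 < ip (T x0) x0 ->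
  exists M g, [/\ c < M, W g, 0 < nsq g & nsq (T g - M *: g) = 0].
Proof.
move=> cW TW c0 Wx0 hx0.
have nsq_gt0 x : nsq x != 0 -> 0 < nsq x by rewrite lt_neqAle eq_sym => ->; exact: nsq_ge0.
have xp : 0 < nsq x0.
  apply: nsq_gt0; apply/eqP => x00; move: hx0.
  by rewrite ipC ip_nsq0 // x00 mulr0 ltxx.
pose E := [set r | exists x, [/\ W x, 0 < nsq x & r = ip (T x) x / nsq x]].
have ubE : has_ubound E.
  exists ((B + 1) / 2) => _ [x [_ x_gt0 ->]].
  by rewrite ler_pdivrMr // ip_T_le.
have E0 : E (ip (T x0) x0 / nsq x0) by exists x0.
pose M := sup E.
have cM : c < M.
  by apply: lt_le_trans (ub_le_sup ubE E0); rewrite ltr_pdivlMr.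
have formM x : W x -> ip (T x) x <= M * nsq x.
  move=> Wx; have [x00|/nsq_gt0 x_gt0] := eqVneq (nsq x) 0.
    by rewrite ipC ip_nsq0 // x00 mulr0.
  by rewrite -ler_pdivrMr //; apply: ub_le_sup => //; exists x.
have M0 : M != 0 by rewrite gt_eqF // (le_lt_trans c0).
case: (fredholm_alternative cW M0) => [[delta d0 hd]|[z [Wz z0 Tz]]]; last first.
  by exists M, z.
exfalso.
have Mp : 0 < M by exact: le_lt_trans cM.
(* [C * nsq] bounds the form of [M - T]. Nonnegativity of that form at [x + C^-1 (T x - M x)] then
   yields [nsq (T x - M x) <= C (M nsq x - <T x, x>)]. *)
pose C := M + (B + 1) / 2.
have Cp : 0 < C by rewrite /C; have := hs_bound_ge0; lra.
(* Cauchy-Schwarz for the nonnegative form <(M - T) x, y> on W. *)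
have key x : W x -> delta * nsq x <= C * (M * nsq x - ip (T x) x).
  move=> Wx; apply: le_trans (hd _ Wx) _.
  pose y := T x - M *: x.
  have [W0 WD _] := cW.
  have Wy : W y by rewrite /y addrC -scaleNr; apply: WD => //; exact: TW.
  have Wz : W (C^-1 *: y + x) by exact: WD.
  have eq1 : ip y (T x) - M * ip y x = nsq y by rewrite -ipZr -ipBr.
  rewrite -/y; clearbody y.
  have := formM _ Wz.
  have -> : nsq (C^-1 *: y + x) = C^-1 ^+ 2 * nsq y + 2 * C^-1 * ip y x + nsq x.
    by rewrite nsqD nsqZ ipZl; ring.
  have -> : ip (T (C^-1 *: y + x)) (C^-1 *: y + x) =
      C^-1 ^+ 2 * ip (T y) y + 2 * C^-1 * ip y (T x) + ip (T x) x.
    by rewrite T_lin !ipDl !ipDr !ipZl !ipZr (T_sym y x) (ipC _ (T x) y); ring.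
  have hC : - ip (T y) y <= (B + 1) / 2 * nsq y.
    have := ip_le ip (T y) y; have := hs_bounded y; have := ler_norm (- ip (T y) y).
    by rewrite normrN; lra.
  have -> : ip y (T x) = nsq y + M * ip y x by rewrite -eq1; ring.
  have hC2 : C^-1 ^+ 2 * (M * nsq y - ip (T y) y) <= C^-1 * nsq y.
    rewrite expr2 -mulrA ler_pM2l ?invr_gt0 // mulrC ler_pdivrMr //.
    by rewrite /C; lra.
  move=> h.
  have : C^-1 * nsq y <= M * nsq x - ip (T x) x by lra.
  by rewrite mulrC ler_pdivrMr // mulrC.
pose r := M - delta / C.
have rM : r < M by rewrite /r ltrBlDr ltrDl divr_gt0.
have : M <= r.
  apply: ge_sup; first by exists (ip (T x0) x0 / nsq x0).
  move=> _ [x [Wx x_gt0 ->]]; rewrite ler_pdivrMr // /r mulrBl.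
  have := key x Wx; rewrite -ler_pdivrMl // => h.
  have -> : delta / C * nsq x = C^-1 * (delta * nsq x) by ring.
  by lra.
by rewrite leNgt rM.
Qed.

End Operator.
End Fredholm.

(** * Overlap of spectral subspaces *)

Section Families.
Context {R : realType} {V : lmodType R} (ip : semi_inner V).
Local Notation nsq := (nsq ip).
Local Notation proj := (orth_proj ip).
Local Notation onf := (onf ip).

Lemma weak_eigen T l e y : nsq (T e - l *: e) = 0 -> ip (T e) y = l * ip e y.
Proof.
move=> /(ip_nsq0 y) /eqP; rewrite ipBl ipZl subr_eq0 => /eqP; exact.
Qed.

(** Write [x = p + y] with [p] the projection on the family. Up to null vectors [T] preserves the
    span of the eigenvectors, so the cross terms of the form vanish, and Pythagoras gives
    [nsq y]. *)
Lemma form_bound {I : eqType} (s : seq I) (e : I -> V) (l : I -> R) (T : V -> V) c x :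
  linear T -> symmetric ip T -> onf s e ->
  {in s, forall i, nsq (T (e i) - l i *: e i) = 0} ->
  (forall x, {in s, forall i, ip x (e i) = 0} -> ip (T x) x <= c * nsq x) ->
  ip (T x) x <= \sum_(i <- s) l i * ip x (e i) ^+ 2 +
                c * (nsq x - \sum_(i <- s) ip x (e i) ^+ 2).
Proof.
move=> T_lin T_sym oe Te hc.
pose p := proj s e x; pose y := x - p.
have hy i : i \in s -> ip y (e i) = 0 by exact: ip_resid.
have yx : x = p + y by rewrite addrC subrK.
have TD u v : T (u + v) = T u + T v by rewrite -[u]scale1r T_lin !scale1r.
have Tp z : ip (T p) z = \sum_(i <- s) l i * ip x (e i) * ip z (e i).
  rewrite T_sym ip_suml; apply: eq_big_seq => i si.
  by rewrite ipZl -T_sym (weak_eigen _ (Te i si)) (ipC _ z); ring.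
have Tpy : ip (T p) y = 0.
  by rewrite Tp big_seq big1 // => i si; rewrite hy ?mulr0.
have Tpp : ip (T p) p = \sum_(i <- s) l i * ip x (e i) ^+ 2.
  rewrite Tp; apply: eq_big_seq => i si.
  by rewrite (ip_proj_in oe) // expr2 mulrA.
have -> : ip (T x) x = ip (T p) p + ip (T y) y.
  have gen u v : ip (T u) v = 0 -> ip (T (u + v)) (u + v) = ip (T u) u + ip (T v) v.
    by move=> uv; rewrite TD !ipDl !ipDr (T_sym v u) (ipC _ v) uv addr0 add0r.
  by rewrite {1 2}yx gen.
rewrite Tpp lerD2l -nsq_resid //; exact: hc.
Qed.

Lemma sum_form {I J : eqType} (s : seq I) (t : seq J) (a : I -> R) (h : I -> J -> R) :
  \sum_(j <- t) \sum_(i <- s) a i * h i j = \sum_(i <- s) a i * \sum_(j <- t) h i j.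
Proof. by rewrite exchange_big /=; apply: eq_bigr => i _; rewrite mulr_sumr. Qed.

Lemma sum1_size {I : Type} (s : seq I) : \sum_(i <- s) (1 : R) = (size s)%:R.
Proof. by rewrite big_const_seq count_predT iter_addr_0. Qed.

Lemma sum_deficit {I : Type} (s : seq I) (a h : I -> R) c :
  \sum_(i <- s) (a i - c) * (1 - h i) = \sum_(i <- s) a i - c * (size s)%:R -
    \sum_(i <- s) a i * h i + c * \sum_(i <- s) h i.
Proof.
rewrite -sum1_size !mulr_sumr -!sumrB -big_split /=.
by apply: eq_bigr => i _; ring.
Qed.

(* Ky Fan's variational principle: the sums of the largest eigenvalues of T
   and T' differ by O(eps), and the top eigenvectors of T' almost attain the
   maximum for T. *)
Lemma ky_fan_overlap {I J : eqType} (s : seq I) (e : I -> V) (t : seq J) (q : J -> V)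
    (T T' : V -> V) (l : I -> R) (l' : J -> R) (c c' g eps : R) :
  onf s e -> onf t q ->
  {in s, forall i, nsq (T (e i) - l i *: e i) = 0} ->
  {in t, forall j, nsq (T' (q j) - l' j *: q j) = 0} ->
  (forall x, ip (T x) x <= \sum_(i <- s) l i * ip x (e i) ^+ 2 +
                c * (nsq x - \sum_(i <- s) ip x (e i) ^+ 2)) ->
  (forall x, ip (T' x) x <= \sum_(j <- t) l' j * ip x (q j) ^+ 2 +
                c' * (nsq x - \sum_(j <- t) ip x (q j) ^+ 2)) ->
  {in s, forall i, c + g <= l i} -> {in t, forall j, c' <= l' j} ->
  0 <= c -> (size t <= size s)%N -> c' * ((size s)%:R - (size t)%:R) = 0 ->
  (forall x, `|ip (T x) x - ip (T' x) x| <= eps * nsq x) ->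
  g * ((size s)%:R - \sum_(i <- s) \sum_(j <- t) ip (e i) (q j) ^+ 2) <=
    2 * (size s)%:R * eps.
Proof.
move=> oe oq Te Tq FT FT' lg l'c c0 ts cz TT'.
have e1 i : i \in s -> nsq (e i) = 1 by move=> si; rewrite /nsq oe.2 // eqxx.
have q1 j : j \in t -> nsq (q j) = 1 by move=> tj; rewrite /nsq oq.2 // eqxx.
set S := \sum_(i <- s) _.
have ts' : (size t)%:R <= (size s)%:R :> R by rewrite ler_nat.
have S_le i : i \in s -> \sum_(j <- t) ip (e i) (q j) ^+ 2 <= 1.
  by move=> si; rewrite -(e1 i si); exact: bessel.
have S'_le j : j \in t -> \sum_(i <- s) ip (e i) (q j) ^+ 2 <= 1.
  move=> tj; rewrite -(q1 j tj); apply: le_trans (bessel oe (q j)).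
  by apply: ler_sum => i _; rewrite ipC.
have SE : S = \sum_(j <- t) \sum_(i <- s) ip (e i) (q j) ^+ 2 by exact: exchange_big.
have traceT : \sum_(i <- s) ip (T (e i)) (e i) = \sum_(i <- s) l i.
  apply: eq_big_seq => i si; rewrite (weak_eigen _ (Te i si)).
  by rewrite -/(nsq _) e1 ?mulr1.
have traceT' : \sum_(j <- t) ip (T' (q j)) (q j) = \sum_(j <- t) l' j.
  apply: eq_big_seq => j tj; rewrite (weak_eigen _ (Tq j tj)).
  by rewrite -/(nsq _) q1 ?mulr1.
have up1 : \sum_(i <- s) ip (T (e i)) (e i) <=
    \sum_(i <- s) ip (T' (e i)) (e i) + eps * (size s)%:R.
  rewrite -sum1_size mulr_sumr -big_split /=.
  rewrite big_seq [leRHS]big_seq; apply: ler_sum => i si.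
  have := TT' (e i); rewrite e1 // ler_norml => /andP[_]; lra.
have up2 : \sum_(j <- t) ip (T' (q j)) (q j) <=
    \sum_(j <- t) ip (T (q j)) (q j) + eps * (size t)%:R.
  rewrite -sum1_size mulr_sumr -big_split /=.
  rewrite big_seq [leRHS]big_seq; apply: ler_sum => j tj.
  have := TT' (q j); rewrite q1 // ler_norml => /andP[]; lra.
have eps0 : 0 <= eps * (size s)%:R.
  rewrite -sum1_size mulr_sumr big_seq sumr_ge0 // => i si.
  by have := TT' (e i); rewrite e1 //; apply: le_trans.
have eps1 : eps * (size t)%:R <= eps * (size s)%:R.
  have [s0|s0] := posnP (size s).
    by move: ts; rewrite s0 leqn0 => /eqP ->.
  by rewrite ler_wpM2l //; move: eps0; rewrite pmulr_lge0 // ltr0n.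
(* The family [e] is a trial family for [T']. The bound leaves the excess [c' * (size s - size t)],
   which vanishes by hypothesis: either the family [q] has full size or the next eigenvalue of [T']
   is 0. *)
have step1 : \sum_(i <- s) ip (T' (e i)) (e i) <= \sum_(j <- t) l' j.
  have : \sum_(i <- s) ip (T' (e i)) (e i) <=
      \sum_(i <- s) (\sum_(j <- t) l' j * ip (e i) (q j) ^+ 2 +
         c' * (1 - \sum_(j <- t) ip (e i) (q j) ^+ 2)).
    rewrite big_seq [leRHS]big_seq; apply: ler_sum => i si.
    by rewrite -(e1 i si).
  rewrite big_split /= -mulr_sumr sumrB sum1_size -/S.
  rewrite (sum_form t s l' (fun j i => ip (e i) (q j) ^+ 2)).
  have : 0 <= \sum_(j <- t) (l' j - c') * (1 - \sum_(i <- s) ip (e i) (q j) ^+ 2).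
    rewrite big_seq; apply: sumr_ge0 => j tj.
    by rewrite mulr_ge0 // subr_ge0 ?l'c ?S'_le.
  rewrite sum_deficit -SE.
  by move: cz; lra.
(* The family [q] is a trial family for [T], and here the gap enters: each [l i] exceeds [c] by at
   least [g], so every unit of missing overlap lowers the trace by at least [g]. *)
have step2 : \sum_(j <- t) ip (T (q j)) (q j) <=
    \sum_(i <- s) l i - g * ((size s)%:R - S).
  have : \sum_(j <- t) ip (T (q j)) (q j) <=
      \sum_(j <- t) (\sum_(i <- s) l i * ip (e i) (q j) ^+ 2 +
         c * (1 - \sum_(i <- s) ip (e i) (q j) ^+ 2)).
    rewrite big_seq [leRHS]big_seq; apply: ler_sum => j tj.
    rewrite -(q1 j tj); under eq_bigr do rewrite ipC.
    by under [X in _ - X]eq_bigr do rewrite ipC; exact: FT.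
  rewrite big_split /= -mulr_sumr sumrB sum1_size -SE.
  rewrite (sum_form s t l (fun i j => ip (e i) (q j) ^+ 2)).
  have : 0 <= \sum_(i <- s) (l i - (c + g)) * (1 - \sum_(j <- t) ip (e i) (q j) ^+ 2).
    rewrite big_seq; apply: sumr_ge0 => i si.
    by rewrite mulr_ge0 // subr_ge0 ?lg ?S_le.
  rewrite sum_deficit -/S.
  have := ler_wpM2l c0 ts'; lra.
(* The chain is: trace of [T] on [e], of [T'] on [e], of [T'] on [q], of [T] on [q]. The two changes
   of operator cost at most [eps * size s] each, and the first trace equals [\sum l i], which
   cancels against the bound of [step2]. *)
lra.
Qed.

Lemma nsq_sum_le {I : Type} (s : seq I) (v : I -> V) :
  nsq (\sum_(i <- s) v i) <= (size s)%:R * \sum_(i <- s) nsq (v i).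
Proof.
have -> : nsq (\sum_(i <- s) v i) = \sum_(i <- s) \sum_(j <- s) ip (v i) (v j).
  by rewrite /nsq ip_suml; apply: eq_bigr => i _; rewrite ip_sumr.
have : \sum_(i <- s) \sum_(j <- s) ip (v i) (v j) <=
    \sum_(i <- s) \sum_(j <- s) (nsq (v i) / 2 + nsq (v j) / 2).
  apply: ler_sum => i _; apply: ler_sum => j _.
  have := ip_le ip (v i) (v j); have := ler_norm (ip (v i) (v j)); lra.
move/le_trans; apply; rewrite le_eqVlt; apply/orP; left; apply/eqP.
pose A := \sum_(i <- s) nsq (v i) / 2.
have nA (a : R) : \sum_(i <- s) a = a * (size s)%:R.
  by rewrite big_const_seq count_predT iter_addr_0 mulr_natr.
under eq_bigr do rewrite big_split /= nA -/A.
rewrite big_split /= nA -mulr_suml -/A mulr_sumr.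
have -> : A = (\sum_(i <- s) nsq (v i)) / 2 by rewrite mulr_suml.
by rewrite -mulr_sumr; field.
Qed.

Lemma proj_linear {I : eqType} (s : seq I) (e : I -> V) : linear (proj s e).
Proof.
move=> a x y; rewrite /proj scaler_sumr -big_split /=; apply: eq_bigr => i _.
by rewrite ipDl ipZl scalerDl scalerA.
Qed.

Lemma proj_id {I : eqType} (s : seq I) (e : I -> V) x y :
  ip (proj s e x) y = ip x (proj s e y).
Proof.
by rewrite ip_proj ipC ip_proj; apply: eq_bigr => i _; rewrite mulrC.
Qed.

(** With [P] and [Q] the projections on [e] and [q], [Q - P = (1 - P) Q - P (1 - Q)]. Let [S] be the
    total overlap. Summed over [r], Bessel bounds the second term by [size s - S] and the first by
    [size t * (size t - S)]; the factor [size t] comes from [nsq_sum_le] and is harmless because it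
    stays bounded by [size s]. *)
Lemma proj_diff_hs {I J K : eqType} (s : seq I) (e : I -> V) (t : seq J) (q : J -> V)
    (u : seq K) (r : K -> V) :
  onf s e -> onf t q -> onf u r -> (size t <= size s)%N ->
  \sum_(k <- u) nsq (proj t q (r k) - proj s e (r k)) <=
  2 * (1 + (size s)%:R) *
    ((size s)%:R - \sum_(i <- s) \sum_(j <- t) ip (e i) (q j) ^+ 2).
Proof.
move=> oe oq ou ts; set S := \sum_(i <- s) _.
have ts' : (size t)%:R <= (size s)%:R :> R by rewrite ler_nat.
have SE : S = \sum_(j <- t) \sum_(i <- s) ip (q j) (e i) ^+ 2.
  by rewrite /S exchange_big; apply: eq_bigr => i _; apply: eq_bigr => j _; rewrite ipC.
pose v j := q j - proj s e (q j).
have hv : \sum_(j <- t) nsq (v j) = (size t)%:R - S.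
  rewrite SE -sum1_size -sumrB; apply: eq_big_seq => j tj.
  by rewrite nsq_resid // {1}/nsq oq.2 // eqxx.
have he : \sum_(i <- s) nsq (e i - proj t q (e i)) = (size s)%:R - S.
  rewrite /S -sum1_size -sumrB; apply: eq_big_seq => i si.
  by rewrite nsq_resid // {1}/nsq oe.2 // eqxx.
have bnd k : nsq (proj t q (r k) - proj s e (r k)) <=
    2 * (\sum_(j <- t) (size t)%:R * (ip (q j) (r k) ^+ 2 * nsq (v j))) +
    2 * \sum_(i <- s) ip (e i - proj t q (e i)) (r k) ^+ 2.
  set x := r k.
  have [psD pB] : (forall a y z, proj s e (a *: y + z) = a *: proj s e y + proj s e z) /\
     forall y z, proj s e (y - z) = proj s e y - proj s e z.
    split; first exact: proj_linear.
    by move=> y z; rewrite addrC -scaleN1r proj_linear scaleN1r addrC.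
  have -> : proj t q x - proj s e x =
      (proj t q x - proj s e (proj t q x)) - proj s e (x - proj t q x).
    by rewrite pB opprB addrA subrK.
  apply: le_trans (nsqB_le _ _ _) _; rewrite lerD ?ler_pM2l //.
    have -> : proj t q x - proj s e (proj t q x) =
        \sum_(j <- t) ip x (q j) *: v j.
      rewrite /v; under eq_bigr do rewrite scalerBr.
      rewrite sumrB; congr (_ - _).
      have -> : proj t q x = \sum_(j <- t) ip x (q j) *: q j by []; elim: t {oq ts ts' SE hv he S v} => [|j t IH].
        by rewrite !big_nil; have := pB 0 0; rewrite !subrr.
      by rewrite !big_cons psD IH.
    rewrite -mulr_sumr; apply: le_trans (nsq_sum_le _ _) _.
    by rewrite le_eqVlt; apply/orP; left; apply/eqP; congr (_ * _);
       apply: eq_bigr => j _; rewrite nsqZ ipC.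
  rewrite nsq_proj // le_eqVlt; apply/orP; left; apply/eqP.
  by apply: eq_bigr => i _; rewrite ipBl ipBl proj_id !(ipC _ x).
apply: le_trans (ler_sum _ (fun k _ => bnd k)) _.
rewrite big_split /= -!mulr_sumr.
have b1 : \sum_(k <- u) \sum_(j <- t) (size t)%:R * (ip (q j) (r k) ^+ 2 * nsq (v j))
    <= (size t)%:R * ((size t)%:R - S).
  rewrite exchange_big /= -hv mulr_sumr big_seq [leRHS]big_seq.
  apply: ler_sum => j tj; rewrite -mulr_sumr -mulr_suml ler_wpM2l //.
  rewrite -[leRHS]mul1r ler_wpM2r ?nsq_ge0 //.
  apply: le_trans (bessel ou (q j)) _.
  by rewrite /nsq oq.2 // eqxx.
have b2 : \sum_(k <- u) \sum_(i <- s) ip (e i - proj t q (e i)) (r k) ^+ 2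
    <= (size s)%:R - S.
  by rewrite exchange_big /= -he; apply: ler_sum => i _; exact: bessel.
have b3 : (size t)%:R * ((size t)%:R - S) <= (size s)%:R * ((size s)%:R - S).
  by apply: ler_pM => //; [rewrite -hv sumr_ge0 // => *; exact: nsq_ge0|lra].
lra.
Qed.

End Families.

(** * Enumerated eigenvectors of an abstract symmetric operator *)

Section SpectralSystem.
Context {R : realType} {V : lmodType R} (ip : semi_inner V).
Hypothesis V_complete : complete ip.
Local Notation nsq := (nsq ip).
Local Notation proj := (orth_proj ip).
Local Notation onf := (onf ip).

(* The real Hilbert space underlying a complex one: every complex eigenvector
   [phi i] contributes the real pair [psi (i, false) = phi i] and
   [psi (i, true) = 'i * phi i]. *)
Record spectral_system (T : V -> V) (lam : int -> R) (psi : int * bool -> V) := {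
  sys_lin : linear T;
  sys_sym : symmetric ip T;
  sys_hs : exists B, hilbert_schmidt ip T B;
  sys_ord : spectrally_ordered lam;
  sys_onf : forall p q, nonzero_indices lam p.1 -> nonzero_indices lam q.1 ->
    ip (psi p) (psi q) = (p == q)%:R;
  sys_eigen : forall p, nonzero_indices lam p.1 ->
    nsq (T (psi p) - lam p.1 *: psi p) = 0;
  sys_total : forall l g, l != 0 -> nsq (T g - l *: g) = 0 ->
    (forall p, nonzero_indices lam p.1 -> lam p.1 = l -> ip g (psi p) = 0) -> nsq g = 0 }.

Lemma opp_hilbert_schmidt (T : V -> V) B :
  hilbert_schmidt ip T B -> hilbert_schmidt ip (fun x => - T x) B.
Proof. by move=> h m e oe; under eq_bigr do rewrite nsqN; exact: h. Qed.

Lemma opp_linear (T : V -> V) : linear T -> linear (fun x => - T x).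
Proof. by move=> h a x y; rewrite h opprD scalerN. Qed.

Lemma opp_symmetric (T : V -> V) : symmetric ip T -> symmetric ip (fun x => - T x).
Proof. by move=> h x y; rewrite ipNl ipNr h. Qed.

(** Negating the indices exchanges the two monotone halves of the enumeration, so results on
    positive eigenvalues transfer to negative ones. *)
Lemma opp_system T lam psi : spectral_system T lam psi ->
  spectral_system (fun x => - T x) (fun i => - lam (- i)) (fun p => psi (- p.1, p.2)).
Proof.
have nz i : nonzero_indices (fun i => - lam (- i)) i -> nonzero_indices lam (- i).
  by rewrite /nonzero_indices /= !oppr_eq0.
case=> Tl Ts [B Th] [d1 d2 d3 d4] To Te Tt; split.
- exact: opp_linear.
- exact: opp_symmetric.
- by exists B; exact: opp_hilbert_schmidt.
- split=> i.
  + by move=> j i0 ij; rewrite lerN2; apply: d2; rewrite ?lerN2 ?oppr_lt0.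
  + by move=> j ij j0; rewrite lerN2; apply: d1; rewrite ?lerN2 ?oppr_gt0.
  + by move=> i0; rewrite oppr_ge0; apply: d4; rewrite oppr_lt0.
  + by move=> i0; rewrite oppr_le0; apply: d3; rewrite oppr_gt0.
- move=> [i b] [j c] /= /nz hi /nz hj; rewrite To //=.
  by congr (nat_of_bool _)%:R; rewrite !xpair_eqE eqr_opp.
- move=> [i b] /= /nz hi; rewrite -nsqN opprB scaleNr opprK addrC.
  exact: (Te (- i, b)).
- move=> l g l0 hg h; apply: (Tt (- l)); rewrite ?oppr_eq0 //.
    by rewrite -nsqN opprB addrC scaleNr.
  move=> [i b] hi /= il; have := h (- i, b); rewrite /= !opprK; apply.
    by move: hi; rewrite /nonzero_indices /= opprK !oppr_eq0.
  by rewrite il opprK.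
Qed.

(** Padding indices are filtered out because the vectors [psi (i, _)] are arbitrary where
    [lam i = 0]. *)
Definition idx (lam : int -> R) (s : seq int) : seq (int * bool) :=
  [seq (i, b) | i <- [seq i <- s | lam i != 0], b <- [:: false; true]].

Lemma mem_idx lam s p : (p \in idx lam s) = (p.1 \in s) && (lam p.1 != 0).
Proof.
case: p => i b; apply/allpairsP/idP => /= [[[j c]] /= [+ _ [-> _]]|].
  by rewrite mem_filter andbC.
by rewrite andbC => h; exists (i, b); rewrite mem_filter; split=> //; case: b.
Qed.

Lemma size_idx lam s : size (idx lam s) = (2 * count (fun i => lam i != 0%R) s)%N.
Proof. by rewrite size_allpairs size_filter mulnC. Qed.

Lemma idx_cat lam s t : idx lam (s ++ t) = idx lam s ++ idx lam t.
Proof. by rewrite /idx filter_cat allpairs_cat. Qed.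

Lemma proj_cat {I : eqType} (s t : seq I) e x :
  proj (s ++ t) e x = proj s e x + proj t e x.
Proof. by rewrite /proj /orth_proj big_cat. Qed.

Section Positive.
Context (T : V -> V) (lam : int -> R) (psi : int * bool -> V).
Hypothesis sys : spectral_system T lam psi.

Lemma onf_idx s : uniq s -> 0 \notin s -> onf (idx lam s) psi.
Proof.
move=> us s0; split.
  by apply: allpairs_uniq => // [|[i b] [j c] _ _ []-> ->//]; rewrite filter_uniq.
move=> p q; rewrite !mem_idx => /andP[ps p0] /andP[qs q0].
by apply: (sys_onf sys); split=> //; [apply: contraNneq s0 => <-|apply: contraNneq s0 => <-].
Qed.

Lemma eigen_idx s : 0 \notin s ->
  {in idx lam s, forall p, nsq (T (psi p) - lam p.1 *: psi p) = 0}.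
Proof.
move=> s0 p; rewrite mem_idx => /andP[ps p0]; apply: (sys_eigen sys); split=> //.
by apply: contraNneq s0 => <-.
Qed.

Definition posidx a n : seq int := [seq Posz k.+1 | k <- iota a n].

Lemma posidx_uniq a n : uniq (posidx a n).
Proof. by rewrite map_inj_uniq ?iota_uniq // => i j []. Qed.

Lemma posidx0 a n : 0 \notin posidx a n.
Proof. by apply/mapP => -[]. Qed.

Lemma mem_posidx a n k : (Posz k.+1 \in posidx a n) = (a <= k < a + n)%N.
Proof. by rewrite mem_map ?mem_iota // => i j []. Qed.

(** If the form exceeded the (k+1)-st eigenvalue on the complement of the first [k] pairs,
    [top_eigenvector] would give there an eigenvector for some [M] above that eigenvalue. By
    monotonicity every listed index with value [M] is among the first [k], so this vector is
    orthogonal to all listed eigenvectors for [M], against [sys_total]. *)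
Lemma positive_form_bound k x : ip (T x) x <=
  \sum_(p <- idx lam (posidx 0 k)) lam p.1 * ip x (psi p) ^+ 2 +
  lam k.+1 * (nsq x - \sum_(p <- idx lam (posidx 0 k)) ip x (psi p) ^+ 2).
Proof.
have [Tl Ts [B Th] [d1 d2 d3 d4] To Te Tt] := sys.
have s0 := posidx0 0 k.
apply: (form_bound (l := fun p : int * bool => lam p.1)) => //.
- by apply: onf_idx => //; exact: posidx_uniq.
- exact: eigen_idx.
move=> y hy; rewrite leNgt; apply/negP => lt.
pose W z := forall v, (exists2 p, p \in idx lam (posidx 0 k) & v = psi p) -> ip z v = 0.
have [||||M [g [cM Wg g0 Tg]]] := top_eigenvector V_complete Tl Ts Th
    (W := W) _ _ _ _ lt.
- exact: closed_subspace_perp.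
- move=> z Wz _ [p ps ->].
  by rewrite Ts ipC (weak_eigen z (eigen_idx s0 ps)) ipC Wz ?mulr0 //; exists p.
- exact: d3.
- by move=> _ [p ps ->]; exact: hy.
have M0 : 0 < M by apply: le_lt_trans cM; exact: d3.
suff : nsq g = 0 by move/eqP; rewrite gt_eqF.
apply: (Tt M) => //; first by rewrite gt_eqF.
move=> [i b] [/= i0 li0] li; apply: Wg; exists (i, b) => //.
rewrite mem_idx li0 andbT /=.
case: i => [[|i]|i] in i0 li0 li *; first by rewrite eqxx in i0.
  rewrite mem_posidx /= add0n ltnNge; apply/negP => ki.
  by have := d1 k.+1 i.+1 isT (_ : _ <= _); rewrite li lez_nat ltnS => /(_ ki); rewrite leNgt cM.
by have := d4 (Negz i) isT; rewrite li leNgt M0.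
Qed.

(** The factor 2 counts the real pair of each complex eigenvector. The size falls short only if
    padding starts within the first [k] places, and by monotonicity [lam k] is then 0. *)
Lemma positive_size k :
  (size (idx lam (posidx 0 k)) <= 2 * k)%N /\
  (lam k != 0 -> size (idx lam (posidx 0 k)) = (2 * k)%N).
Proof.
have sz : size (posidx 0 k) = k by rewrite size_map size_iota.
rewrite size_idx; split; first by rewrite leq_mul2l /= -{2}sz count_size.
move=> lk; congr (2 * _)%N; rewrite -{2}sz; apply/eqP; rewrite -all_count.
apply/allP => _ /mapP[i + ->]; rewrite mem_iota add0n => /andP[_ ik].
have [d1 _ d3 _] := sys_ord sys.
have lk0 : 0 < lam k.
  rewrite lt_neqAle eq_sym lk; apply: d3; rewrite ltz_nat; exact: leq_ltn_trans ik.
by rewrite gt_eqF // (lt_le_trans lk0) //; exact: d1.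
Qed.

(* Infinitely many eigenvectors for values >= mu contradict the Hilbert-Schmidt bound. *)
Lemma positive_finite mu : 0 < mu -> exists k, lam (Posz k.+1) < mu.
Proof.
move=> mu0; apply: contrapT => no.
have ge k : mu <= lam (Posz k.+1).
  by rewrite leNgt; apply/negP => h; apply: no; exists k.
have nz k : nonzero_indices lam (Posz k.+1).
  by split=> //; rewrite gt_eqF // (lt_le_trans mu0).
have [B Th] := sys_hs sys.
pose m := (Num.truncn (B / mu ^+ 2)).+1.
have /Th : onf (iota 0 m) (fun k => psi (Posz k.+1, false)).
  split=> [|i j _ _]; first exact: iota_uniq.
  rewrite (sys_onf sys); [congr (nat_of_bool _)%:R|exact: nz|exact: nz].
  by apply/eqP/eqP => [[]|->].
apply/negP; rewrite -ltNge; apply: lt_le_trans (_ : m%:R * mu ^+ 2 <= _).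
  by rewrite -ltr_pdivrMr ?exprn_gt0 // truncnS_gt.
have -> : m%:R * mu ^+ 2 = \sum_(i <- iota 0 m) mu ^+ 2.
  by rewrite big_const_seq count_predT size_iota iter_addr_0 mulr_natl.
apply: ler_sum => i _.
set p := (_, _); have hp : nonzero_indices lam p.1 by exact: nz.
have := sys_eigen sys hp => /(weak_eigen (T (psi p))).
rewrite -/(nsq _) => ->.
rewrite ipC (weak_eigen _ (sys_eigen sys hp)) (sys_onf sys) // eqxx mulr1 -expr2.
by apply: lerXn2r; rewrite ?nnegrE;
  [exact: ltW|exact: le_trans (ltW mu0) (ge i)|exact: ge].
Qed.

End Positive.
End SpectralSystem.

(** * Convergence of the spectral projections *)

Section Convergence.
Context {R : realType} {V : lmodType R} (ip : semi_inner V).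
Hypothesis V_complete : complete ip.
Local Notation nsq := (nsq ip).
Local Notation proj := (orth_proj ip).
Local Notation onf := (onf ip).

(** This is Hilbert-Schmidt convergence on the real space, expressed by finite real orthonormal
    families; complex orthonormal families are among them. *)
Definition hs_tends (An : nat -> V -> V) (A : V -> V) :=
  forall eps, 0 < eps -> exists N, forall n, (N <= n)%N ->
    forall m (r : nat -> V), onf (iota 0 m) r ->
    \sum_(k <- iota 0 m) nsq (An n (r k) - A (r k)) <= eps.

Definition form_tends (Tn : nat -> V -> V) (T : V -> V) :=
  forall eps, 0 < eps -> exists N, forall n, (N <= n)%N ->
    forall x, `|ip (T x) x - ip (Tn n x) x| <= eps * nsq x.

Lemma hs_tendsB An A Cn C : hs_tends An A -> hs_tends Cn C ->
  hs_tends (fun n x => An n x - Cn n x) (fun x => A x - C x).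
Proof.
move=> hA hC eps eps0; have e4 : 0 < eps / 4 by lra.
have [N hN] := hA _ e4; have [M hM] := hC _ e4.
exists (maxn N M) => n; rewrite geq_max => /andP[Nn Mn] m r hr.
have := hN n Nn m r hr; have := hM n Mn m r hr => h1 h2.
have : \sum_(k <- iota 0 m) nsq (An n (r k) - Cn n (r k) - (A (r k) - C (r k))) <=
    \sum_(k <- iota 0 m) (2 * nsq (An n (r k) - A (r k)) + 2 * nsq (Cn n (r k) - C (r k))).
  apply: ler_sum => k _; apply: le_trans (nsqB_le ip _ _).
  rewrite le_eqVlt; apply/orP; left; apply/eqP; congr (nsq _).
  by rewrite !opprB [LHS]addrACA [RHS]addrACA (addrC (- Cn n _)).
by rewrite big_split /= -!mulr_sumr; lra.
Qed.

Lemma eq_hs_tends An A Cn C : (forall n x, An n x = Cn n x) -> (forall x, A x = C x) ->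
  hs_tends An A -> hs_tends Cn C.
Proof.
move=> hA h hh eps /hh[N hN]; exists N => n Nn m r hr.
by under eq_bigr do rewrite -hA -h; exact: hN.
Qed.

(** A single normalized vector is an orthonormal family, which gives convergence at [x]. Null
    vectors cannot be normalized and are settled by the contraction bounds. *)
Lemma hs_tends_app An A x : linear A -> (forall n, linear (An n)) ->
  (forall n x, nsq (An n x) <= nsq x) -> (forall x, nsq (A x) <= nsq x) ->
  hs_tends An A -> tends ip (fun n => An n x) (A x).
Proof.
move=> Al Anl bn b hA eps eps0.
have [x0|xn0] := eqVneq (nsq x) 0.
  exists 0%N => n _; apply: le_lt_trans (nsqB_le ip _ _) _.
  by have := bn n x; have := b x; rewrite x0; lra.
have xp : 0 < nsq x by rewrite lt_neqAle eq_sym xn0 nsq_ge0.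
have e0 : 0 < eps / (2 * nsq x) by rewrite divr_gt0 // mulr_gt0.
have [N hN] := hA _ e0; exists N => n Nn.
pose c := (Num.sqrt (nsq x))^-1.
have := hN n Nn 1 (fun=> c *: x); rewrite big_cons big_nil addr0.
have AZ (B : V -> V) y : linear B -> B (c *: y) = c *: B y.
  move=> Bl; have B0 : B 0 = 0 by have := Bl (-1) 0 0; rewrite scaler0 addr0 scaleN1r addNr.
  by have := Bl c y 0; rewrite B0 !addr0.
rewrite (AZ _ x (Anl n)) (AZ _ x Al) -scalerBr nsqZ exprVn sqr_sqrtr ?(ltW xp) // => h.
have : (nsq x)^-1 * nsq (An n x - A x) <= eps / (2 * nsq x).
  apply: h; split=> // i j; rewrite !inE => /eqP -> /eqP ->.
  by rewrite -/(nsq _) onf_normalize.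
rewrite mulrC ler_pdivrMr // => h1; apply: le_lt_trans h1 _.
have -> : eps / (2 * nsq x) * nsq x = eps / 2 by field; rewrite gt_eqF.
lra.
Qed.

Section Positive.
Context (T : V -> V) (lam : int -> R) (psi : int * bool -> V).
Context (Tn : nat -> V -> V) (lamn : nat -> int -> R) (psin : nat -> int * bool -> V).
Hypotheses (sys : spectral_system ip T lam psi)
  (sysn : forall n, spectral_system ip (Tn n) (lamn n) (psin n))
  (TnT : form_tends Tn T).

Lemma head_tends k : k = 0%N \/ lam (Posz k.+1) < lam (Posz k) ->
  hs_tends (fun n => proj (idx (lamn n) (posidx 0 k)) (psin n))
           (proj (idx lam (posidx 0 k)) psi).
Proof.
move=> hk.
have [g g0 hg] : exists2 g, 0 < g & {in idx lam (posidx 0 k), forall p, lam (Posz k.+1) + g <= lam p.1}.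
  case: hk => [->|lk]; first by exists 1.
  exists (lam k - lam k.+1); first by rewrite subr_gt0.
  move=> p; rewrite addrC subrK mem_idx => /andP[/mapP[i + ->] _].
  rewrite mem_iota add0n => /andP[_ ik]; have [d1 _ _ _] := sys_ord sys.
  exact: d1.
have sz : size (idx lam (posidx 0 k)) = (2 * k)%N.
  case: hk => [->//|lk]; apply: (positive_size sys k).2.
  rewrite gt_eqF //; apply: le_lt_trans lk.
  by have [_ _ + _] := sys_ord sys; apply.
move=> eps eps0.
(* [C] is the factor [2 (1 + 2k)] of [proj_diff_hs] times the factor [2 * 2k] of [ky_fan_overlap].
   The tolerance for the forms also carries [g], since the overlap deficit is controlled only after
   division by the gap. *)
pose C : R := 2 * (1 + (2 * k)%:R) * (2 * (2 * k)%:R).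
have C0 : 0 <= C by rewrite /C; have := ler0n R (2 * k); nra.
have e0 : 0 < eps * g / (C + 1) by rewrite divr_gt0 ?mulr_gt0 //; lra.
have [N hN] := TnT e0; exists N => n Nn m r hr.
have us := posidx_uniq 0 k; have s0 := posidx0 0 k.
have oe := onf_idx sys us s0; have oq := onf_idx (sysn n) us s0.
have ts : (size (idx (lamn n) (posidx 0 k)) <= size (idx lam (posidx 0 k)))%N.
  by rewrite sz; apply: (positive_size (sysn n) k).1.
apply: le_trans (proj_diff_hs oe oq hr ts) _; rewrite sz.
have [e1 e2 e3 e4] := sys_ord (sysn n).
have [d1 d2 d3 d4] := sys_ord sys.
have := ky_fan_overlap (l := fun p : int * bool => lam p.1)
  (l' := fun p : int * bool => lamn n p.1) oe oq (eigen_idx sys s0) (eigen_idx (sysn n) s0)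
  (positive_form_bound V_complete sys k) (positive_form_bound V_complete (sysn n) k) hg.
rewrite sz => /(_ (eps * g / (C + 1))) kf.
have {kf} : g * ((2 * k)%:R - \sum_(p <- idx lam (posidx 0 k))
    \sum_(q <- idx (lamn n) (posidx 0 k)) ip (psi p) (psin n q) ^+ 2) <=
    2 * (2 * k)%:R * (eps * g / (C + 1)).
  apply: kf => //.
  - move=> p; rewrite mem_idx => /andP[/mapP[i + ->] _].
    rewrite mem_iota add0n => /andP[_ ik]; apply: e1 => //.
    by rewrite lez_nat ltnW.
  - exact: d3.
  - by rewrite -sz.
  (* If the (k+1)-st eigenvalue of the n-th operator is nonzero, so are the first [k], and both
     families have size [2k]. *)
  - have [l0|l0] := eqVneq (lamn n (Posz k.+1)) 0; first by rewrite l0 mul0r.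
    have [->|k0] := posnP k; first by rewrite subrr mulr0.
    rewrite (positive_size (sysn n) k).2 ?subrr ?mulr0 //.
    have l1 : 0 < lamn n (Posz k.+1) by rewrite lt_neqAle eq_sym l0 e3.
    by apply/lt0r_neq0/(lt_le_trans l1)/e1; rewrite ?ltz_nat ?lez_nat.
  - exact: hN.
set D := _ - _ => h.
have D0 : D <= 2 * (2 * k)%:R * (eps / (C + 1)).
  rewrite -(ler_pM2l g0); apply: (le_trans h); rewrite le_eqVlt; apply/orP; left.
  by apply/eqP; field; lra.
have : 2 * (1 + (2 * k)%:R) * D <= C * (eps / (C + 1)).
  have k0 : 0 <= 2 * (1 + (2 * k)%:R) :> R by have := ler0n R (2 * k); lra.
  by have := ler_wpM2l k0 D0; rewrite /C; lra.
move/le_trans; apply; rewrite mulrA ler_pdivrMr; last by lra.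
by rewrite mulrC ler_pM2l //; lra.
Qed.

(** By monotonicity the indices with value [mu] are consecutive, from [a + 1] to [c], where [a] and
    [c] are the least [k] with [lam (k + 1) = mu] and with [lam (k + 1) < mu]. Minimality gives a
    gap after place [c] and, unless [a = 0], one after place [a], so [head_tends] applies at both
    ends. *)
Lemma positive_block mu : 0 < mu -> (exists i, i != 0 /\ lam i = mu) ->
  exists s : seq int, [/\ uniq s, (forall i, i \in s <-> i != 0 /\ lam i = mu) &
    hs_tends (fun n => proj (idx (lamn n) s) (psin n)) (proj (idx lam s) psi)].
Proof.
move=> mu0 [i0 [i00 li0]]; have [d1 d2 d3 d4] := sys_ord sys.
have pos i : i != 0 -> lam i = mu -> exists k, i = Posz k.+1.
  case: i => [[|i]|i] // _ li; first by exists i.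
  by have := d4 (Negz i) isT; rewrite li leNgt mu0.
have [k0 k0E] := pos _ i00 li0.
have exa : exists k, lam (Posz k.+1) == mu by exists k0; rewrite -k0E li0.
have exc : exists k, lam (Posz k.+1) < mu by exact: (positive_finite sys mu0).
case: (ex_minnP exa) => a /eqP la amin; case: (ex_minnP exc) => c lc cmin.
have noninc i j : (i <= j)%N -> lam (Posz j.+1) <= lam (Posz i.+1).
  by move=> ij; apply: d1 => //; rewrite lez_nat.
have ac : (a < c)%N.
  by rewrite ltnNge; apply/negP => /noninc; rewrite la leNgt lc.
pose s := posidx a (c - a).
have ms k : Posz k.+1 \in s <-> lam (Posz k.+1) = mu.
  rewrite mem_posidx subnKC ?(ltnW ac) //; split=> [/andP[ak kc]|lk].
    apply/eqP; rewrite eq_le -{1}la noninc //= leNgt; apply/negP => /cmin.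
    by rewrite leqNgt kc.
  rewrite amin ?lk //= ltnNge; apply/negP => /noninc; rewrite lk leNgt.
  by rewrite lc.
exists s; split; first exact: posidx_uniq.
  move=> i; split=> [si|[/[dup] i1 /pos h li]].
    have /mapP[k _ ik] := si; split; first by rewrite ik.
    by move: si; rewrite ik => /ms.
  by have [k ik] := h li; move: li; rewrite ik => /ms.
have split_at l : idx l (posidx 0 c) = idx l (posidx 0 a) ++ idx l s.
  by rewrite -idx_cat /posidx -map_cat -{2}[a]add0n -iotaD subnKC // ltnW.
have hc : lam (Posz c.+1) < lam (Posz c).
  case: c lc cmin ac {s ms split_at} => // c lc cmin ac.
  by apply: (lt_le_trans lc); rewrite leNgt; apply/negP => /cmin; rewrite ltnn.
have ha : a = 0%N \/ lam (Posz a.+1) < lam (Posz a).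
  case: a la amin {ac s ms split_at} => [|a] la amin; first by left.
  right; rewrite lt_neqAle noninc //= andbT la eq_sym; apply/negP => h.
  by have := amin a h; rewrite ltnn.
apply: eq_hs_tends (hs_tendsB (head_tends (or_intror hc)) (head_tends ha)).
  by move=> n x; rewrite split_at proj_cat addrC addKr.
by move=> x; rewrite split_at proj_cat addrC addKr.
Qed.

End Positive.

Lemma opp_form_tends Tn T : form_tends Tn T ->
  form_tends (fun n x => - Tn n x) (fun x => - T x).
Proof.
move=> h eps /h[N hN]; exists N => n Nn x; rewrite !ipNl -opprD normrN.
exact: hN.
Qed.

Lemma proj_opp (lam : int -> R) (psi : int * bool -> V) s x :
  proj (idx lam [seq - i | i <- s]) psi x =
  proj (idx (fun i => - lam (- i)) s) (fun p => psi (- p.1, p.2)) x.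
Proof.
have -> : idx lam [seq - i | i <- s] =
    [seq (- p.1, p.2) | p <- idx (fun i => - lam (- i)) s].
  rewrite /idx filter_map allpairs_mapl map_allpairs /=.
  by rewrite (@eq_filter _ _ (fun i => - lam (- i) != 0)) // => i; rewrite /= oppr_eq0.
by rewrite /orth_proj big_map.
Qed.

Lemma eigenvalue_block (T : V -> V) lam psi
    (Tn : nat -> V -> V) (lamn : nat -> int -> R) psin mu :
  spectral_system ip T lam psi ->
  (forall n, spectral_system ip (Tn n) (lamn n) (psin n)) -> form_tends Tn T ->
  mu != 0 -> (exists i, i != 0 /\ lam i = mu) ->
  exists s : seq int, [/\ uniq s, (forall i, i \in s <-> i != 0 /\ lam i = mu) &
    hs_tends (fun n => proj (idx (lamn n) s) (psin n)) (proj (idx lam s) psi)].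
Proof.
move=> sys sysn hT mu0 [i0 [i00 li0]].
have [mup|] := ltP 0 mu; first by apply: (positive_block sys sysn hT mup); exists i0.
rewrite le_eqVlt (negbTE mu0) /= => mun.
have [||s [us hs ht]] := positive_block (opp_system sys) (fun n => opp_system (sysn n))
    (opp_form_tends hT) (mu := - mu).
- by rewrite oppr_gt0.
- by exists (- i0); rewrite oppr_eq0 opprK li0.
exists [seq - i | i <- s]; split.
- by rewrite map_inj_uniq //; exact: oppr_inj.
- move=> i; rewrite -(opprK i) mem_map; last exact: oppr_inj.
  rewrite opprK; split=> [/hs[]|[]]; rewrite ?opprK ?oppr_eq0.
    by move=> ? /oppr_inj.
  by move=> i1 li; apply/hs; rewrite opprK oppr_eq0 li.
- by apply: eq_hs_tends ht => [n x|x]; rewrite proj_opp.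
Qed.

End Convergence.

(** * Parseval's identity for vectors orthogonal to the kernel *)

Section Parseval.
Context {R : realType} {V : lmodType R} (ip : semi_inner V).
Hypothesis V_complete : complete ip.
Local Notation nsq := (nsq ip).
Local Notation proj := (orth_proj ip).
Local Notation onf := (onf ip).

Lemma ler_sum_subset {I : eqType} (s t : seq I) (F : I -> R) :
  uniq s -> uniq t -> {subset s <= t} -> (forall i, 0 <= F i) ->
  \sum_(i <- s) F i <= \sum_(i <- t) F i.
Proof.
move=> us ut st F0; rewrite [leRHS](bigID (fun i => i \in s)) /=.
have st' : perm_eq [seq i <- t | i \in s] s.
  apply: uniq_perm; rewrite ?filter_uniq // => i; rewrite mem_filter.
  by case: (boolP (i \in s)) => // /st.
by rewrite -[X in _ <= X + _]big_filter (perm_big _ st') /= lerDl sumr_ge0.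
Qed.

Lemma nsq_proj_le {I : eqType} (s : seq I) e x : onf s e -> nsq (proj s e x) <= nsq x.
Proof. by move=> oe; rewrite nsq_proj //; exact: bessel. Qed.

Lemma form_zero_on T B (W : V -> Prop) : linear T -> symmetric ip T ->
  hilbert_schmidt ip T B -> closed_subspace ip W -> (forall x, W x -> W (T x)) ->
  (forall l g, l != 0 -> W g -> nsq (T g - l *: g) = 0 -> nsq g = 0) ->
  forall x, W x -> ip (T x) x <= 0.
Proof.
move=> Tl Ts Th cW TW no x Wx; rewrite leNgt; apply/negP => h.
have [|M [g [M0 Wg g0 Tg]]] := top_eigenvector V_complete Tl Ts Th cW TW (lexx 0) Wx _.
- by rewrite mul0r.
by move: (no _ _ (lt0r_neq0 M0) Wg Tg) => /eqP; rewrite gt_eqF.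
Qed.

Section System.
Context (T : V -> V) (lam : int -> R) (psi : int * bool -> V).
Hypothesis sys : spectral_system ip T lam psi.

(** The complement [W] of all listed eigenvectors is invariant and contains no eigenvector for a
    nonzero value, so neither [T] nor [- T] has a positive form value on [W]. The form thus vanishes
    on [W], and its value at [g + T g] is [2 nsq (T g)]. *)
Lemma perp_null g : (forall p, nonzero_indices lam p.1 -> ip g (psi p) = 0) ->
  nsq (T g) = 0.
Proof.
move=> gW; have [Tl Ts [B Th] _ To Te Tt] := sys.
pose W z := forall v, (exists2 p, nonzero_indices lam p.1 & v = psi p) -> ip z v = 0.
have cW : closed_subspace ip W by exact: closed_subspace_perp.
have TW x : W x -> W (T x).
  move=> Wx _ [p ps ->].
  by rewrite Ts ipC (weak_eigen x (Te _ ps)) ipC Wx ?mulr0 //; exists p.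
have no l h : l != 0 -> W h -> nsq (T h - l *: h) = 0 -> nsq h = 0.
  by move=> l0 Wh /(Tt l h l0); apply => p hp _; apply: Wh; exists p.
have zero x : W x -> ip (T x) x = 0.
  move=> Wx; apply/eqP; rewrite eq_le.
  rewrite (form_zero_on Tl Ts Th cW TW no Wx) /= -oppr_le0 -ipNl.
  apply: (form_zero_on (opp_linear Tl) (opp_symmetric Ts) (opp_hilbert_schmidt Th) cW) => //.
    by move=> y Wy; rewrite -scaleN1r -[_ *: _]addr0; have [W0 WD _] := cW; apply: WD => //; exact: TW.
  move=> l h l0 Wh hh; apply: (no (- l)) => //; first by rewrite oppr_eq0.
  by rewrite -nsqN opprB addrC scaleNr.
have Wg : W g by move=> _ [p hp ->]; exact: gW.
have [W0 WD _] := cW.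
have := zero _ (WD 1 _ _ Wg (TW _ Wg)).
rewrite scale1r -{1}[g]scale1r Tl scale1r !ipDl !ipDr (zero _ Wg) (zero _ (TW _ Wg)).
rewrite (Ts (T g) g) -/(nsq _); lra.
Qed.

Definition allidx n : seq int := posidx 0 n ++ [seq - i | i <- posidx 0 n].

Lemma mem_allidx n i : (i \in allidx n) = (0 < absz i <= n)%N.
Proof.
rewrite mem_cat; case: i => [[|k]|k].
- rewrite (negbTE (posidx0 _ _)) /=; apply/negbTE/mapP => -[j /mapP[k _ ->]].
  by rewrite -NegzE.
- rewrite mem_posidx /= add0n orb_idr // => /mapP[j /mapP[k' _ ->]].
  by rewrite -NegzE.
- rewrite NegzE mem_map; last exact: oppr_inj.
  by rewrite mem_posidx /= add0n orb_idl // => /mapP[j _]; rewrite -NegzE.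
Qed.

Lemma allidx_uniq n : uniq (allidx n).
Proof.
rewrite cat_uniq posidx_uniq map_inj_uniq ?posidx_uniq ?andbT; last exact: oppr_inj.
by apply/hasPn => _ /mapP[_ /mapP[k _ ->] ->]; apply/negP => /mapP[j _]; rewrite -NegzE.
Qed.

Lemma allidx0 n : 0 \notin allidx n.
Proof. by rewrite mem_allidx. Qed.

(** The projections of [f] on growing finite families are Cauchy, because their squared norms
    increase and are bounded by Bessel. If [x] is the limit, [g = f - x] is orthogonal to every
    eigenvector, hence killed by [T], hence orthogonal to [f]; it is orthogonal to [x] as well, so
    it is null. *)
Lemma parseval f eps : (forall h, nsq (T h) = 0 -> ip f h = 0) -> 0 < eps ->
  exists s, [/\ uniq s, 0 \notin s &
    nsq f - eps < \sum_(p <- idx lam s) ip f (psi p) ^+ 2].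
Proof.
move=> hf eps0.
pose I n := idx lam (allidx n).
have oI n : onf (I n) psi := onf_idx sys (allidx_uniq n) (allidx0 n).
pose u n := proj (I n) psi f.
pose a n := \sum_(p <- I n) ip f (psi p) ^+ 2.
have sI m n : (m <= n)%N -> {subset I m <= I n}.
  move=> mn p; rewrite !mem_idx !mem_allidx => /andP[/andP[-> pm] ->].
  by rewrite (leq_trans pm).
have un m n p : (m <= n)%N -> p \in I m -> ip (u n) (psi p) = ip f (psi p).
  by move=> mn pm; rewrite ip_proj_in //; exact: (sI _ _ mn).
have ua m n : (m <= n)%N -> nsq (u n - u m) = a n - a m.
  move=> mn; rewrite nsqB !nsq_proj // -/(a n) -/(a m) (ipC _ (u n)) ip_proj.
  have -> : \sum_(p <- I m) ip f (psi p) * ip (u n) (psi p) = a m.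
    by apply: eq_big_seq => p pm; rewrite (un m) // expr2.
  by ring.
have a_le n : a n <= nsq f by exact: bessel.
pose E := range a.
have supE : has_sup E by split; [exists (a 0%N), 0%N|exists (nsq f) => _ [n _ <-]].
have [x ux] : exists x, tends ip u x.
  apply: V_complete => e e0.
  have [_ [N _ <-] hN] := sup_adherent e0 supE.
  have close m n : (N <= m)%N -> (m <= n)%N -> nsq (u n - u m) < e.
    move=> Nm mn; rewrite ua //.
    have : a n <= sup E by apply: ub_le_sup; [exact: supE.2|exists n].
    have : a N <= a m by rewrite -subr_ge0 -ua // nsq_ge0.
    by lra.
  exists N => m n Nm Nn; have [mn|/ltnW nm] := leqP m n; last exact: close.
  by rewrite nsqBC; exact: close.
have xf p : nonzero_indices lam p.1 -> ip x (psi p) = ip f (psi p).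
  move=> [p0 lp].
  (* The shift by [absz p.1] puts [p] into the family from the first term on, so the inner products
     with [psi p] are constant, as [tends_ip] requires. *)
  have tu : tends ip (fun n => u (n + absz p.1)%N) x.
    by move=> e /ux[N hN]; exists N => n Nn; apply: hN; apply: leq_trans (leq_addr _ _).
  apply: (tends_ip tu) => n; apply: (un (absz p.1)); first exact: leq_addl.
  by rewrite mem_idx lp mem_allidx leqnn absz_gt0 p0.
pose g := f - x.
have gpsi p : nonzero_indices lam p.1 -> ip g (psi p) = 0.
  by move=> hp; rewrite ipBl xf // subrr.
have fg : ip f g = 0 by apply: hf; exact: perp_null.
have xg : ip x g = 0.
  apply: (tends_ip ux) => n; rewrite ip_proj big_seq big1 // => p.
  rewrite mem_idx mem_allidx => /andP[/andP[p0 _] lp].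
  by rewrite gpsi ?mulr0 //; split=> //; rewrite -absz_gt0.
have g0 : nsq g = 0 by rewrite {1}/nsq {1}/g ipBl fg xg subrr.
have e4 : 0 < eps / 4 by lra.
have [N hN] := ux _ e4; exists (allidx N); split; [exact: allidx_uniq|exact: allidx0|].
rewrite -/(I N) -/(a N).
have := nsq_resid (oI N) f; rewrite -/(a N) -/(u N) => h.
have := nsqB_le ip g (u N - x); rewrite g0.
have -> : g - (u N - x) = f - u N by rewrite /g opprB addrA subrK.
by have := hN N (leqnn _); lra.
Qed.

End System.
End Parseval.

(** * Sums over all eigenvalue blocks *)

Section BlockSum.
Context {R : realType} {V : lmodType R} (ip : semi_inner V).
Hypothesis V_complete : complete ip.
Local Notation nsq := (nsq ip).
Local Notation proj := (orth_proj ip).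
Local Notation onf := (onf ip).

(** Young's inequality with weight [eta]. The error proportional to [nsq x] can be summed over
    orthogonal blocks and made small by [eta]; the large factor [eta^-1] falls only on the
    difference. *)
Lemma nsq_upper eta x y : 0 < eta ->
  nsq y <= nsq x + eta * nsq x + (1 + eta^-1) * nsq (y - x).
Proof.
move=> eta0; have yE : nsq y = nsq x + 2 * ip x (y - x) + nsq (y - x) by rewrite -nsqD addrC subrK.
have := nsq_ge0 ip (x - eta^-1 *: (y - x)).
rewrite yE [nsq (x - _ *: _)]nsqB nsqZ ipZr; clear yE.
move: (nsq x) (ip x (y - x)) (nsq (y - x)) => a b c h.
have : 0 <= eta * (a - 2 * (eta^-1 * b) + eta^-1 ^+ 2 * c) by rewrite mulr_ge0 // ltW.
have -> : eta * (a - 2 * (eta^-1 * b) + eta^-1 ^+ 2 * c) = eta * a - 2 * b + eta^-1 * c.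
  by field; rewrite gt_eqF.
lra.
Qed.

Lemma nsq_lower eta x y : 0 < eta ->
  nsq x <= nsq y + eta * nsq x + eta^-1 * nsq (y - x).
Proof.
move=> eta0; have yE : nsq y = nsq x + 2 * ip x (y - x) + nsq (y - x) by rewrite -nsqD addrC subrK.
have := nsq_ge0 ip (x + eta^-1 *: (y - x)).
rewrite yE [nsq (x + _ *: _)]nsqD nsqZ ipZr; clear yE.
move: (nsq_ge0 ip (y - x)).
move: (nsq x) (ip x (y - x)) (nsq (y - x)) => a b c c0 h.
have : 0 <= eta * (a + 2 * (eta^-1 * b) + eta^-1 ^+ 2 * c) by rewrite mulr_ge0 // ltW.
have -> : eta * (a + 2 * (eta^-1 * b) + eta^-1 ^+ 2 * c) = eta * a + 2 * b + eta^-1 * c.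
  by field; rewrite gt_eqF.
lra.
Qed.

Lemma tends_app (An : nat -> V -> V) A fn f : (forall n, linear (An n)) ->
  (forall n x, nsq (An n x) <= nsq x) -> tends ip fn f ->
  tends ip (fun n => An n f) (A f) -> tends ip (fun n => An n (fn n)) (A f).
Proof.
move=> Al bn hf hA eps eps0; have e4 : 0 < eps / 4 by lra.
have [N hN] := hf _ e4; have [M hM] := hA _ e4.
exists (maxn N M) => n; rewrite geq_max => /andP[Nn Mn].
have -> : An n (fn n) - A f = An n (fn n - f) + (An n f - A f).
  have -> : An n (fn n - f) = An n (fn n) - An n f.
    by rewrite addrC -scaleN1r Al scaleN1r addrC.
  by rewrite addrA subrK.
apply: le_lt_trans (nsqD_le ip _ _) _.
by have := hN n Nn; have := hM n Mn; have := bn n (fn n - f); lra.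
Qed.

Lemma tends_sum {J : eqType} (F : seq J) (b : nat -> J -> V) a :
  (forall j, j \in F -> tends ip (b^~ j) (a j)) ->
  forall eps, 0 < eps -> exists N, forall n, (N <= n)%N ->
    \sum_(j <- F) nsq (b n j - a j) <= eps.
Proof.
elim: F => [|j F IH] h eps eps0; first by exists 0%N => n _; rewrite big_nil ltW.
have e2 : 0 < eps / 2 by lra.
have [|N hN] := IH _ _ e2; first by move=> i iF; apply: h; rewrite inE iF orbT.
have [M hM] := h j (mem_head _ _) _ e2.
exists (maxn N M) => n; rewrite geq_max => /andP[Nn Mn]; rewrite big_cons.
by have := hN n Nn; have := hM n Mn; lra.
Qed.

Section Blocks.
Context (s : int -> seq int).
Hypotheses (s_uniq : forall j, uniq (s j)) (s0 : forall j, 0 \notin s j)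
  (s_disj : forall i j k, k \in s i -> k \in s j -> i = j).

Definition blocks (F : seq int) : seq int := flatten [seq s j | j <- F].

Lemma blocks_uniq F : uniq F -> uniq (blocks F).
Proof.
elim: F => //= j F IH /andP[jF uF]; rewrite cat_uniq s_uniq IH // andbT.
apply/hasPn => k /flatten_mapP[i iF ki]; apply/negP => kj.
by move: jF; rewrite (s_disj kj ki) iF.
Qed.

Lemma blocks0 F : 0 \notin blocks F.
Proof. by apply/flatten_mapP => -[j _]; apply/negP. Qed.

Lemma blocks_sum (l : int -> R) F (G : int * bool -> R) :
  \sum_(p <- idx l (blocks F)) G p = \sum_(j <- F) \sum_(p <- idx l (s j)) G p.
Proof.
elim: F => [|j F IH]; first by rewrite !big_nil.
by rewrite big_cons /blocks /= idx_cat big_cat /= -IH.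
Qed.

Lemma blocks_nsq T l psi F x : spectral_system ip T l psi ->
  \sum_(j <- F) nsq (proj (idx l (s j)) psi x) =
  \sum_(p <- idx l (blocks F)) ip x (psi p) ^+ 2.
Proof.
move=> sys; rewrite blocks_sum; apply: eq_bigr => j _.
by rewrite nsq_proj //; apply: (onf_idx sys).
Qed.

Lemma blocks_bessel T l psi F x : spectral_system ip T l psi -> uniq F ->
  \sum_(j <- F) nsq (proj (idx l (s j)) psi x) <= nsq x.
Proof.
move=> sys uF; rewrite (blocks_nsq _ _ sys); apply: bessel.
by apply: (onf_idx sys); [exact: blocks_uniq|exact: blocks0].
Qed.

(** The threshold is chosen before [F]: the sum over all blocks is a supremum over finite [F], so
    the bound has to be uniform. The set [J] that carries almost all the mass of [f] is fixed before
    [n]. *)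
Lemma block_sum_tends T lam psi Tn lamn psin fn f :
  spectral_system ip T lam psi ->
  (forall n, spectral_system ip (Tn n) (lamn n) (psin n)) ->
  (forall i, i != 0 -> lam i != 0 -> exists j, i \in s j) ->
  tends ip fn f -> (forall h, nsq (T h) = 0 -> ip f h = 0) ->
  (forall j, tends ip (fun n => proj (idx (lamn n) (s j)) (psin n) (fn n))
                      (proj (idx lam (s j)) psi f)) ->
  forall eps, 0 < eps -> exists N, forall n, (N <= n)%N -> forall F : seq int, uniq F ->
    \sum_(j <- F) nsq (proj (idx (lamn n) (s j)) (psin n) (fn n) -
                       proj (idx lam (s j)) psi f) <= eps.
Proof.
move=> sys sysn cover ffn f0 tj eps eps0.
(* The blocks in [J] contribute at most [delta], those outside at most [2 * 5 delta + 2 * delta]. *)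
pose delta := eps / 13; have delta0 : 0 < delta by rewrite /delta; lra.
have [s1 [us1 s10 hs1]] := parseval V_complete sys f0 delta0.
have /choice[jof hjof] i : exists j, i != 0 -> lam i != 0 -> i \in s j.
  have [i0|i0] := eqVneq i 0; first by exists 0.
  have [l0|l0] := eqVneq (lam i) 0; first by exists 0.
  by have [j] := cover i i0 l0; exists j.
pose J := undup [seq jof i | i <- s1].
have uJ : uniq J by exact: undup_uniq.
pose a j := proj (idx lam (s j)) psi f.
pose b n j := proj (idx (lamn n) (s j)) (psin n) (fn n).
have aJ : nsq f - delta < \sum_(j <- J) nsq (a j).
  apply: (lt_le_trans hs1); rewrite (blocks_nsq _ _ sys).
  apply: ler_sum_subset => [|||p]; last exact: sqr_ge0.
  - exact: (onf_idx sys us1 s10).1.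
  - exact: (onf_idx sys (blocks_uniq uJ) (blocks0 J)).1.
  move=> p; rewrite !mem_idx => /andP[ps lp]; rewrite lp andbT.
  have p0 : p.1 != 0 by apply: contraNneq s10 => <-.
  apply/flatten_mapP; exists (jof p.1); last exact: hjof.
  by rewrite mem_undup map_f.
(* This makes [eta * nsq f <= delta]; the 1 covers a null [f]. *)
pose eta := delta / (nsq f + 1).
have f1 : 0 < nsq f + 1 by have := nsq_ge0 ip f; lra.
have eta0 : 0 < eta by rewrite divr_gt0.
have etaf : eta * nsq f <= delta.
  by rewrite /eta mulrAC ler_pdivrMr // ler_pM2l //; lra.
have q0 : 0 < 1 + eta^-1 by rewrite addr_gt0 // invr_gt0.
have dq0 : 0 < delta / (1 + eta^-1) by rewrite divr_gt0.
have [N hN] := ffn _ dq0.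
have [M hM] := tends_sum (F := J) (b := b) (fun j _ => tj j) dq0.
exists (maxn N M) => n; rewrite geq_max => /andP[Nn Mn] F uF.
have := hN n Nn; rewrite ltr_pdivlMr // mulrC => fnN.
have := hM n Mn; rewrite ler_pdivlMr // mulrC => bJ.
have ei0 : 0 <= eta^-1 by rewrite invr_ge0 ltW.
have fn_le : nsq (fn n) <= nsq f + 2 * delta.
  by have := nsq_upper f (fn n) eta0; lra.
have sumJ0 : 0 <= \sum_(j <- J) nsq (b n j - a j).
  by apply: sumr_ge0 => j _; exact: nsq_ge0.
have aJle : \sum_(j <- J) nsq (a j) <= nsq f by exact: (blocks_bessel _ sys).
(* Of the three losses of [delta], one is the mass of [f] missed by [J] and two are the errors of
   [nsq_lower]. With [nsq (fn n) <= nsq f + 2 delta], Bessel then leaves at most [5 delta] for the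
   blocks of the n-th operator outside [J]. *)
have bJge : nsq f - 3 * delta <= \sum_(j <- J) nsq (b n j).
  have : \sum_(j <- J) nsq (a j) <= \sum_(j <- J)
      (nsq (b n j) + eta * nsq (a j) + eta^-1 * nsq (b n j - a j)).
    by apply: ler_sum => j _; exact: nsq_lower.
  rewrite !big_split /= -!mulr_sumr.
  have := ler_wpM2l (ltW eta0) aJle.
  by move: bJ sumJ0; rewrite mulrDl mul1r; lra.
pose K := [seq j <- F | j \notin J].
have uKJ : uniq (K ++ J).
  rewrite cat_uniq uJ filter_uniq // andbT /=; apply/hasPn => j jJ.
  by rewrite mem_filter jJ.
have bK : \sum_(j <- K) nsq (b n j) <= 5 * delta.
  have := blocks_bessel (fn n) (sysn n) uKJ; rewrite big_cat /=; lra.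
have aK : \sum_(j <- K) nsq (a j) <= delta.
  by have := blocks_bessel f sys uKJ; rewrite big_cat /=; lra.
have dK : \sum_(j <- K) nsq (b n j - a j) <= 12 * delta.
  have : \sum_(j <- K) nsq (b n j - a j) <= \sum_(j <- K) (2 * nsq (b n j) + 2 * nsq (a j)).
    by apply: ler_sum => j _; exact: nsqB_le.
  by rewrite big_split /= -!mulr_sumr; lra.
have dJ : \sum_(j <- [seq j <- F | j \in J]) nsq (b n j - a j) <= delta.
  apply: le_trans (_ : \sum_(j <- J) nsq (b n j - a j) <= _).
    apply: ler_sum_subset => [|//|j|j]; last exact: nsq_ge0.
      by rewrite filter_uniq.
    by rewrite mem_filter => /andP[].
  by have := mulr_ge0 ei0 sumJ0; move: bJ; rewrite mulrDl mul1r; lra.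
rewrite -/(a _) (bigID (fun j => j \in J)) /= -[X in X + _]big_filter.
rewrite -[X in _ + X]big_filter -/K.
have -> : eps = 13 * delta by rewrite /delta; field.
by apply: le_trans (lerD dJ dK) _; lra.
Qed.

End Blocks.
End BlockSum.

(** * The Hilbert space of square-integrable functions *)

Section RealL2.
Context {R : realType} {d : measure_display} {X : measurableType d}.
Variable mu : probability X R.

Lemma le1_2 : (1 <= 2%:E :> \bar R)%E.
Proof. by rewrite lee_fin ler1n. Qed.

Definition realL2 := LfunType mu le1_2.
HB.instance Definition _ := GRing.Lmodule.on realL2.
Implicit Types f g : realL2.

Lemma Lfun2P (f : X -> R) : f \in Lfun mu 2%:E <->
  measurable_fun setT f /\ (\int[mu]_x (f x ^+ 2)%:E < +oo)%E.
Proof.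
have sqE : (\int[mu]_x ((`|(f x)%:E| `^ 2)) = \int[mu]_x (f x ^+ 2)%:E)%E.
  by apply: eq_integral => x _; rewrite /= powR_mulrn // real_normK // num_real.
have normE : (Lnorm mu 2%:E (EFin \o f) = (\int[mu]_x (f x ^+ 2)%:E) `^ 2^-1)%E.
  by rewrite unlock sqE.
have p0 : (0 <= \int[mu]_x (f x ^+ 2)%:E)%E.
  by apply: integral_ge0 => x _; rewrite lee_fin sqr_ge0.
split=> [/andP[]|[mf hf]].
  rewrite !inE /= /finite_norm normE => mf; split=> //.
  exact: (lty_poweRy (r := 2^-1)).
apply/andP; rewrite !inE /=; split=> //; rewrite /finite_norm normE.
exact: poweR_lty.
Qed.

Definition mkL2 (f : X -> R) (hf : f \in Lfun mu 2%:E) : realL2 := Lfun_Sub le1_2 hf.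

Lemma L2_in f : (f : X -> R) \in Lfun mu 2%:E. Proof. exact: LfunP. Qed.

Lemma L2_measurable f : measurable_fun setT f.
Proof. by have /Lfun2P[] := L2_in f. Qed.

Lemma L2_mul_integrable f g : mu.-integrable setT (EFin \o (fun x => f x * g x)).
Proof. by apply/Lfun1_integrable; exact: Lfun2_mul_Lfun1 (L2_in f) (L2_in g). Qed.

Lemma L2_integrable f : mu.-integrable setT (EFin \o f).
Proof.
by apply/Lfun1_integrable; apply: Lfun_subset12 (L2_in f); exact: fin_num_measure.
Qed.

Definition ipL2 f g : R := \int[mu]_x (f x * g x).

Lemma L2_addE f g x : (f + g) x = f x + g x. Proof. by []. Qed.
Lemma L2_scaleE a f x : (a *: f) x = a * f x. Proof. by []. Qed.
Lemma L2_oppE f x : (- f) x = - f x. Proof. by []. Qed.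

Lemma ipL2C f g : ipL2 f g = ipL2 g f.
Proof. by apply: eq_Rintegral => x _; rewrite mulrC. Qed.

Lemma ipL2Dl f g h : ipL2 (f + g) h = ipL2 f h + ipL2 g h.
Proof.
rewrite /ipL2 -RintegralD //; try exact: L2_mul_integrable.
by apply: eq_Rintegral => x _; rewrite L2_addE mulrDl.
Qed.

Lemma ipL2Zl a f g : ipL2 (a *: f) g = a * ipL2 f g.
Proof.
rewrite /ipL2 -RintegralZl //; last exact: L2_mul_integrable.
by apply: eq_Rintegral => x _; rewrite L2_scaleE mulrA.
Qed.

Lemma ipL2_ge0 f : 0 <= ipL2 f f.
Proof. by apply: Rintegral_ge0 => x _; rewrite -expr2 sqr_ge0. Qed.

Definition innerL2 : semi_inner realL2 := SemiInner ipL2C ipL2Dl ipL2Zl ipL2_ge0.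

Lemma nsqL2E f : (nsq innerL2 f)%:E = (\int[mu]_x (f x ^+ 2)%:E)%E.
Proof.
rewrite /nsq /= /ipL2 /Rintegral fineK; last first.
  by apply: integrable_fin_num => //; exact: L2_mul_integrable.
by apply: eq_integral => x _; rewrite expr2.
Qed.

(* Riesz-Fischer: a fast subsequence converges almost everywhere, and Fatou's
   lemma turns this into convergence in norm. *)
Lemma realL2_complete : complete innerL2.
Proof.
move=> u hu.
have q0 k : 0 < (4^-1 : R) ^+ k by rewrite exprn_gt0.
have /choice[F hF] k := hu _ (q0 k).
(* Summing the thresholds makes [N] nondecreasing while [N k] stays above [F k]. *)
pose N k := (\sum_(i < k.+1) F i)%N.
have NF k : (F k <= N k)%N by rewrite /N big_ord_recr leq_addl.
have Nle k m : (k <= m)%N -> (N k <= N m)%N.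
  by apply: (homo_leq (leqnn) leq_trans) => i; rewrite /N [X in (_ <= X)%N]big_ord_recr leq_addr.
pose v k := u (N k).
have hv k m : (k <= m)%N -> nsq innerL2 (v m - v k) < 4^-1 ^+ k.
  by move=> km; apply: hF => //; apply: leq_trans (NF k) (Nle _ _ km).
pose G k x : \bar R := (`|v k.+1 x - v k x|)%:E.
have mvR k : measurable_fun setT (v k) by exact: L2_measurable.
have mG k : measurable_fun setT (G k).
  by apply/measurable_EFinP; apply: measurableT_comp => //; exact: measurable_funB.
have G0 k x : (0 <= G k x)%E by rewrite lee_fin.
(* From [t <= c/2 + t^2/(2c)] with [c = 2^-k]: the squared distance is below [4^-k = c^2], so the
   L^1 distances are summable, with total at most 2. *)
have intG k : (\int[mu]_x G k x <= (2^-1 ^+ k)%:E)%E.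
  have h2 : (0 : R) < 2^-1 ^+ k by rewrite exprn_gt0.
  set c := 2^-1 ^+ k in h2 *.
  pose q x : \bar R := ((v k.+1 x - v k x) ^+ 2)%:E.
  have mq : measurable_fun setT q.
    by apply/measurable_EFinP; apply: measurable_funX; exact: measurable_funB.
  have q_ge0 x : (0 <= q x)%E by rewrite lee_fin sqr_ge0.
  have ci0 : 0 <= c^-1 / 2 by rewrite divr_ge0 // invr_ge0 ltW.
  apply: (@le_trans _ _ (\int[mu]_x ((c / 2)%:E + (c^-1 / 2)%:E * q x))%E).
    apply: ge0_le_integral => //.
      by apply: emeasurable_funD => //; exact: measurable_funeM.
    move=> x _; rewrite /q /G -EFinM -EFinD lee_fin.
    set t := `|_|; have -> : (v k.+1 x - v k x) ^+ 2 = t ^+ 2 by rewrite real_normK // num_real.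
    have : 0 <= c^-1 * (t - c) ^+ 2 by rewrite mulr_ge0 ?sqr_ge0 // invr_ge0 ltW.
    have -> : c^-1 * (t - c) ^+ 2 = c^-1 * t ^+ 2 - 2 * t + c by field; rewrite gt_eqF.
    lra.
  rewrite ge0_integralD //; last 3 first.
  - by move=> x _; rewrite lee_fin divr_ge0 // ltW.
  - by move=> x _; rewrite mule_ge0 // lee_fin.
  - exact: measurable_funeM.
  rewrite ge0_integralZl_EFin //.
  rewrite integral_cst //= probability_setT mule1.
  rewrite -(nsqL2E (v k.+1 - v k)) -EFinM -EFinD lee_fin.
  have := hv _ _ (leqnSn k).
  have -> : (4^-1 : R) ^+ k = 2^-1 ^+ k * 2^-1 ^+ k.
    by rewrite -exprMn; congr (_ ^+ _); field.
  rewrite -/c; set s := nsq _ _ => hs.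
  have : c^-1 * s <= c by rewrite mulrC ler_pdivrMr // ltW.
  lra.
pose S x : \bar R := (\sum_(k <oo) G k x)%E.
have mS : measurable_fun setT S by exact: ge0_emeasurable_sum.
have S0 x : (0 <= S x)%E by exact: nneseries_ge0.
have sumG : (\int[mu]_x S x <= 2%:E)%E.
  rewrite integral_nneseries //.
  apply: lime_le; first by apply: is_cvg_nneseries => k _ _; exact: integral_ge0.
  apply: nearW => n.
  apply: (@le_trans _ _ (\sum_(0 <= k < n) (2^-1 ^+ k)%:E)%E); first exact: lee_sum.
  rewrite sumEFin lee_fin.
  have := @geometric_le_lim R n 1 2^-1 ler01; rewrite /series /geometric /=.
  under eq_bigr do rewrite mul1r.
  have -> : 1 * (1 - 2^-1)^-1 = 2 :> R by field.
  by apply; rewrite ?ger0_norm ?invr_ge0 ?invr_gt0 //; lra.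
have intS : mu.-integrable setT S.
  apply/integrableP; split=> //.
  under eq_integral do rewrite gee0_abs //.
  by apply: le_lt_trans sumG _; rewrite ltry.
have aeS : {ae mu, forall x, cvgn (fun k => v k x)}.
  have := integrable_ae measurableT intS; apply: filterS => x /(_ I) Sx.
  pose g k := v k.+1 x - v k x.
  have gcvg : cvgn (fun n => \sum_(0 <= k < n) `|g k|).
    apply: nondecreasing_is_cvgn.
      by apply/nondecreasing_seqP => n; rewrite big_nat_recr //= lerDl.
    exists (fine (S x)) => _ [n _ <-]; rewrite -lee_fin fineK // -sumEFin.
    exact: nneseries_lim_ge.
  have /cvg_ex[/= l gl] : cvgn (series g) by exact: normed_cvg gcvg.
  apply/cvg_ex; exists (l + v 0%N x).
  have -> : (fun k => v k x) = (fun k => series g k + v 0%N x).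
    by apply/funext => k; rewrite /series /= telescope_sumr // subrK.
  by apply: cvgD => //; exact: cvg_cst.
(* The upper limit is measurable on all of [X] and agrees with the limit wherever the sequence
   converges; [fine] replaces infinite values by 0. *)
pose h x := fine (limn_esup (fun k => (v k x)%:E)).
have mh : measurable_fun setT h.
  apply: measurableT_comp; first exact: fine_measurable.
  by apply: measurable_fun_limn_esup => k; exact/measurable_EFinP.
have hlim x : cvgn (fun k => v k x) -> v k x @[k --> \oo] --> h x.
  move=> /cvg_ex[/= l vl].
  have : (v k x)%:E @[k --> \oo] --> l%:E by exact: cvg_comp vl _.
  by move=> /cvg_limn_einf_sup[_ hl]; rewrite /h hl.
(* Fatou in [m] with [k] fixed: the integrand is almost everywhere the limit of [(v m - v k)^2],
   whose integral is below [4^-k] once [m >= k]. *)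
have fatou_h k : (\int[mu]_x ((h x - v k x) ^+ 2)%:E <= (4^-1 ^+ k)%:E)%E.
  pose D m x : \bar R := ((v m x - v k x) ^+ 2)%:E.
  have mD m : measurable_fun setT (D m).
    by apply/measurable_EFinP; apply: measurable_funX; exact: measurable_funB.
  have D0 m x : (0 <= D m x)%E by rewrite lee_fin sqr_ge0.
  have -> : (\int[mu]_x ((h x - v k x) ^+ 2)%:E = \int[mu]_x limn_einf (D ^~ x))%E.
    apply: ge0_ae_eq_integral => //.
    - by apply/measurable_EFinP; apply: measurable_funX; exact: measurable_funB.
    - apply: measurableT_comp => //; apply: measurable_fun_limn_esup => m.
      by apply: measurableT_comp.
    - by move=> x _; rewrite lee_fin sqr_ge0.
    - move=> x _; rewrite limn_einf_lim; apply: lime_ge; first exact: is_cvg_einfs.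
      by apply: nearW => n; apply: le_ereal_inf_tmp => _ [m _ <-].
    - move: aeS; apply: filterS => x /hlim vh _.
      have : D m x @[m --> \oo] --> ((h x - v k x) ^+ 2)%:E.
        apply: cvg_EFin; first exact: nearW.
        by apply: cvgM; apply: cvgB => //; exact: cvg_cst.
      by move=> /cvg_limn_einf_sup[-> _].
  apply: le_trans (fatou _ _ _ _) _ => //.
  rewrite limn_einf_lim; apply: lime_le; first exact: is_cvg_einfs.
  apply: nearW => n; apply: (@le_trans _ _ (\int[mu]_x D (maxn n k) x)%E).
    by apply: ereal_inf_lbound; exists (maxn n k) => //=; rewrite leq_maxl.
  rewrite -(nsqL2E (v (maxn n k) - v k)) lee_fin ltW //.
  by apply: hv; exact: leq_maxr.
have w0in : (fun x => h x - v 0%N x) \in Lfun mu 2%:E.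
  apply/Lfun2P; split; first exact: measurable_funB.
  by apply: le_lt_trans (fatou_h 0%N) _; rewrite ltry.
pose hh := mkL2 w0in + v 0%N.
have hhE x : hh x = h x by rewrite -[RHS](subrK (v 0%N x)).
have nhv k : nsq innerL2 (hh - v k) <= 4^-1 ^+ k.
  rewrite -lee_fin nsqL2E; apply: le_trans (fatou_h k).
  by under eq_integral do rewrite L2_addE L2_oppE hhE.
exists hh => eps eps0.
have e4 : 0 < eps / 4 by lra.
have [k _ /= hk] := near_infty_natSinv_lt (PosNum e4).
exists (N k) => n Nn.
have -> : u n - hh = (u n - v k) - (hh - v k) by rewrite opprB addrA subrK.
apply: le_lt_trans (nsqB_le innerL2 _ _) _.
have := nhv k; have := hF k n (N k) (leq_trans (NF k) Nn) (NF k); rewrite -/(v k).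
have := hk k (leqnn k).
have : (4^-1 : R) ^+ k <= k.+1%:R^-1.
  rewrite exprVn lef_pV2 ?posrE ?exprn_gt0 // -natrX ler_nat.
  exact: ltn_expl.
set a := 4^-1 ^+ k; set b := _^-1 => /= h1 h2 h3 h4.
by have h5 := le_lt_trans h1 h2; lra.
Qed.

End RealL2.

(** * Graphon operators and the cut norm *)

Section KernelOperator.
Context {R : realType} {d : measure_display} {X : measurableType d}.
Variable mu : probability X R.
Local Notation L2 := (realL2 mu).
Local Notation ip := (innerL2 mu).
Local Notation nsq := (nsq (innerL2 mu)).

(** The bound is on the absolute value so that differences of graphons qualify. *)
Record sym_kernel (u : X * X -> R) : Prop := {
  ker_measurable : measurable_fun setT u;
  ker_le1 : forall z, `|u z| <= 1;
  ker_sym : {ae (mu \x mu)%E, forall z, u (z.1, z.2) = u (z.2, z.1)} }.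

Lemma graphon_kernel w : graphon mu w -> sym_kernel w.
Proof. by case=> mw w01 sw; split=> // z; have /andP[w0 w1] := w01 z; rewrite ger0_norm. Qed.

Lemma graphonB_kernel w1 w2 : graphon mu w1 -> graphon mu w2 -> sym_kernel (w1 \- w2).
Proof.
case=> mw1 w1b sw1 [mw2 w2b sw2]; split; first exact: measurable_funB.
  move=> z; have /andP[a0 a1] := w1b z; have /andP[b0 b1] := w2b z.
  by rewrite ler_norml /=; apply/andP; split; lra.
by move: sw1 sw2; apply: filterS2 => z /= -> ->.
Qed.

Lemma bounded_L2 (f : X -> R) c : measurable_fun setT f -> (forall x, f x ^+ 2 <= c) ->
  f \in Lfun mu 2%:E.
Proof.
move=> mf fc; apply/Lfun2P; split=> //.
apply: (@le_lt_trans _ _ (\int[mu]_x c%:E)%E).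
  apply: ge0_le_integral => //.
  - by move=> x _; rewrite lee_fin sqr_ge0.
  - by apply/measurable_EFinP; exact: measurable_funX.
  - by move=> x _; rewrite lee_fin.
by rewrite integral_cst //= probability_setT mule1 ltry.
Qed.

Lemma nsq_le_bound (f : L2) c : (forall x, f x ^+ 2 <= c) -> nsq f <= c.
Proof.
move=> fc; rewrite -lee_fin nsqL2E.
apply: (@le_trans _ _ (\int[mu]_x c%:E)%E).
  apply: ge0_le_integral => //.
  - by move=> x _; rewrite lee_fin sqr_ge0.
  - by apply/measurable_EFinP; apply: measurable_funX; exact: L2_measurable.
  - by move=> x _; rewrite lee_fin.
by rewrite integral_cst //= probability_setT mule1.
Qed.

Let sqr_le1 (t : R) : `|t| <= 1 -> t ^+ 2 <= 1.
Proof. by move=> t1; rewrite -(real_normK (num_real t)) exprn_ile1. Qed.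

Section Operator.
Context (u : X * X -> R) (hu : sym_kernel u).

Lemma section_in x : (fun y => u (x, y)) \in Lfun mu 2%:E.
Proof.
apply: (@bounded_L2 _ 1); first exact: measurable_fun_pair2 (ker_measurable hu).
by move=> y; exact: sqr_le1 (ker_le1 hu _).
Qed.

Definition sect x : L2 := mkL2 (section_in x).

Lemma nsq_sect x : nsq (sect x) <= 1.
Proof.
apply: nsq_le_bound => y.
exact: sqr_le1 (ker_le1 hu _).
Qed.

Lemma form_measurable (f g : L2) : measurable_fun setT (fun z : X * X => u z * f z.2 * g z.1).
Proof.
apply: measurable_funM; first apply: measurable_funM.
- exact: ker_measurable hu.
- by apply: measurableT_comp => //; exact: L2_measurable.
- by apply: measurableT_comp => //; exact: L2_measurable.
Qed.

(** By Tonelli, from [|u(x,y) f(y) g(x)| <= f(y)^2 + g(x)^2], whose iterated integral is finite on a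
    probability space. *)
Lemma form_integrable (f g : L2) :
  (mu \x mu)%E.-integrable setT (fun z => (u z * f z.2 * g z.1)%:E).
Proof.
apply/integrable12ltyP; first by apply/measurable_EFinP; exact: form_measurable.
have mf := L2_measurable f; have mg := L2_measurable g.
apply: (@le_lt_trans _ _ (\int[mu]_x ((nsq f)%:E + (g x ^+ 2)%:E))%E); last first.
  rewrite ge0_integralD //; last 3 first.
  - by move=> x _; rewrite lee_fin nsq_ge0.
  - by move=> x _; rewrite lee_fin sqr_ge0.
  - by apply/measurable_EFinP; exact: measurable_funX.
  by rewrite integral_cst //= probability_setT mule1 -nsqL2E -EFinD ltry.
apply: ge0_le_integral => //.
- by move=> x _; exact: integral_ge0.
- apply: (measurable_fun_fubini_tonelli_F (fun z => `|(u z * f z.2 * g z.1)%:E|%E)) => //.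
  by apply: measurableT_comp => //; apply/measurable_EFinP; exact: form_measurable.
- by apply: emeasurable_funD => //; apply/measurable_EFinP; exact: measurable_funX.
move=> x _.
apply: (@le_trans _ _ (\int[mu]_y ((f y ^+ 2)%:E + (g x ^+ 2)%:E))%E); last first.
  rewrite ge0_integralD //; last 3 first.
  - by move=> y _; rewrite lee_fin sqr_ge0.
  - by apply/measurable_EFinP; exact: measurable_funX.
  - by move=> y _; rewrite lee_fin sqr_ge0.
  by rewrite integral_cst //= probability_setT mule1 -nsqL2E.
apply: ge0_le_integral => //.
- apply: measurableT_comp => //; apply/measurable_EFinP.
  exact: measurable_fun_pair2 (form_measurable f g).
- by apply: emeasurable_funD => //; apply/measurable_EFinP; exact: measurable_funX.
move=> y _; rewrite /= -EFinD lee_fin !normrM.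
have := ker_le1 hu (x, y); rewrite -(real_normK (num_real (f y))) -(real_normK (num_real (g x))).
move: `|u _| (normr_ge0 (u (x, y))) `|f y| (normr_ge0 (f y)) `|g x| (normr_ge0 (g x)).
move=> a a0 b b0 c c0 a1.
have : a * b * c <= b * c by rewrite -mulrA ler_piMl // mulr_ge0.
have := sqr_ge0 (b - c); nra.
Qed.

(** Sections have norm at most 1, so Cauchy-Schwarz bounds the image pointwise by the norm of [f].
    Measurability comes from Fubini for the form whose second function is the constant 1. *)
Lemma kernel_in (f : L2) : (fun x => ip (sect x) f) \in Lfun mu 2%:E.
Proof.
apply: (@bounded_L2 _ (nsq f)); last first.
  move=> x; apply: le_trans (cauchy_schwarz ip _ _) _.
  by rewrite -[leRHS]mul1r ler_wpM2r ?nsq_ge0 // nsq_sect.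
have -> : (fun x => ip (sect x) f) = fine \o (fun x => \int[mu]_y (u (x, y) * f y)%:E)%E by [].
apply: measurableT_comp; first exact: fine_measurable.
have := form_integrable f (mkL2 (Lfun_cst mu 1 2)).
move/measurable_fubini_F; rewrite /fubini_F /=.
by under eq_fun do under eq_integral do rewrite mulr1.
Qed.

Definition kernel_op (f : L2) : L2 := mkL2 (kernel_in f).

Lemma kernel_opE f x : kernel_op f x = ip (sect x) f. Proof. by []. Qed.

Lemma kernel_op_linear : linear kernel_op.
Proof.
move=> a f g; apply/LfuneqP => x.
by rewrite L2_addE L2_scaleE !kernel_opE ipDr ipZr.
Qed.

Lemma kernel_op_sum_nsq (I : Type) (r : seq I) (e : I -> L2) :
  (forall x, \sum_(i <- r) ip (sect x) (e i) ^+ 2 <= 1) ->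
  \sum_(i <- r) nsq (kernel_op (e i)) <= 1.
Proof.
move=> he.
rewrite -lee_fin -sumEFin; under eq_bigr do rewrite nsqL2E.
rewrite -ge0_integral_sum //; last 2 first.
- move=> i; apply/measurable_EFinP; apply: measurable_funX; exact: L2_measurable.
- by move=> i x _; rewrite lee_fin sqr_ge0.
apply: (@le_trans _ _ (\int[mu]_x (1 : R)%:E)%E); last first.
  by rewrite integral_cst //= probability_setT mule1.
apply: ge0_le_integral => //.
- by move=> x _; apply: sume_ge0 => i _; rewrite lee_fin sqr_ge0.
- apply: emeasurable_sum => i; apply/measurable_EFinP; apply: measurable_funX; exact: L2_measurable.
- by move=> x _; rewrite sumEFin lee_fin; exact: he.
Qed.

Lemma kernel_op_form f g :
  (ip (kernel_op f) g)%:E = (\int[(mu \x mu)%E]_z (u z * f z.2 * g z.1)%:E)%E.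
Proof.
rewrite -(integral12_prod_meas1 (form_integrable f g)) /fubini_F /=.
rewrite /ipL2 /Rintegral fineK; last first.
  by apply: integrable_fin_num => //; exact: L2_mul_integrable.
apply: eq_integral => x _.
have intx : mu.-integrable setT (EFin \o (fun y => u (x, y) * f y)).
  exact: (L2_mul_integrable (sect x) f).
have -> : kernel_op f x * g x = \int[mu]_y (u (x, y) * f y * g x) by rewrite RintegralZr.
rewrite /Rintegral fineK //; apply: integrable_fin_num => //.
by have := integrableZr measurableT (g x) intx.
Qed.

End Operator.

Lemma kernel_op_sym u (hu : sym_kernel u) : symmetric ip (kernel_op hu).
Proof.
move=> f g; rewrite (ipC ip f); apply: EFin_inj; rewrite !kernel_op_form.
(* Symmetry of [u] holds only almost everywhere on the product, so Fubini is applied to the swapped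
   kernel and the two double integrals are compared at the end. *)
have hu' : sym_kernel (u \o swap_pair).
  case: hu => mu_ u1 us; split=> //; first by apply: measurableT_comp => //; exact: measurable_swap.
  by move=> z; exact: u1.
  by move: us; apply: filterS => z /= ->.
rewrite -(integral21_prod_meas1 (form_integrable hu f g)) /fubini_G /=.
have -> : (\int[mu]_y \int[mu]_x (u (x, y) * f y * g x)%:E =
    \int[mu]_x \int[mu]_y (u (y, x) * g y * f x)%:E)%E.
  by apply: eq_integral => x _; apply: eq_integral => y _; rewrite mulrAC.
have := integral12_prod_meas1 (form_integrable hu' g f); rewrite /fubini_F /= => ->.
apply: ae_eq_integral => //.
- exact: measurable_int (form_integrable hu' g f).
- exact: measurable_int (form_integrable hu g f).
by have := ker_sym hu; apply: filterS => z /= us _; rewrite /swap_pair /= -us -surjective_pairing.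
Qed.

End KernelOperator.

(** * Control of quadratic forms by the cut norm *)

Section CutNorm.
Context {R : realType} {d : measure_display} {X : measurableType d}.
Variable mu : probability X R.
Local Notation L2 := (realL2 mu).
Local Notation ip := (innerL2 mu).
Local Notation nsq := (nsq (innerL2 mu)).

Lemma indic_in (S : set X) : measurable S -> (\1_S : X -> R) \in Lfun mu 2%:E.
Proof.
move=> mS; apply: (@bounded_L2 _ _ _ _ _ 1); first exact: measurable_indic.
by move=> x; rewrite indicE; case: (_ \in _); rewrite ?expr1n ?expr0n.
Qed.

Definition indL2 (S : set X) (mS : measurable S) : L2 := mkL2 (indic_in mS).

Lemma indL2E S (mS : measurable S) x : indL2 mS x = (x \in S)%:R.
Proof. by rewrite -indicE. Qed.

Lemma L2_norm_integrable (f : L2) : mu.-integrable setT (EFin \o (fun x => `|f x|)).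
Proof. exact: integrable_norm (L2_integrable f). Qed.

(** [S] is the set where [g >= 0] and [T] its complement; thus L^1 norms reduce to pairings with
    indicators, that is, to cut integrals. *)
Lemma abs_integral_split (g : L2) : exists (S T : set X) (mS : measurable S) (mT : measurable T),
  \int[mu]_x `|g x| = ip g (indL2 mS) - ip g (indL2 mT).
Proof.
have mg := L2_measurable g.
have mS : measurable [set x | 0 <= g x].
  by rewrite -[X in measurable X]setTI; exact: measurable_fun_le.
have mT := measurableC mS.
exists _, _, mS, mT; rewrite /= /ipL2 -RintegralB //; try exact: L2_mul_integrable.
apply: eq_Rintegral => x _; rewrite !indL2E in_setC.
have [gx|gx] := leP 0 (g x).
  by rewrite mem_set //= mulr1 mulr0 subr0 ger0_norm.
by rewrite memNset /= ?mulr0 ?mulr1 ?sub0r ?ltr0_norm //; apply/negP; rewrite -ltNge.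
Qed.

Lemma ip_bounded (g h : L2) s : (forall x, `|g x| <= s) ->
  `|ip g h| <= s * \int[mu]_x `|h x|.
Proof.
move=> gs; apply: le_trans (le_normr_Rintegral _ _) _ => //; first exact: L2_mul_integrable.
rewrite -RintegralZl //; last exact: L2_norm_integrable.
apply: le_Rintegral => //.
- exact: integrable_norm (L2_mul_integrable g h).
- by have := integrableZl measurableT s (L2_norm_integrable h).
- by move=> x _; rewrite normrM ler_wpM2r.
Qed.

Section Kernel.
Context (u : X * X -> R) (hu : sym_kernel mu u) (kappa : R).
Hypothesis cut : forall S T, measurable S -> measurable T ->
  `|\int[(mu \x mu)%E]_(z in S `*` T) u z| <= kappa.
Local Notation K := (kernel_op hu).

Lemma ip_kernel_indic S T (mS : measurable S) (mT : measurable T) :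
  `|ip (K (indL2 mS)) (indL2 mT)| <= kappa.
Proof.
suff -> : ip (K (indL2 mS)) (indL2 mT) = \int[(mu \x mu)%E]_(z in T `*` S) u z by exact: cut.
apply: EFin_inj; rewrite kernel_op_form.
rewrite Rintegral_mkcond /Rintegral.
have E : (fun z : X * X => (u z * indL2 mS z.2 * indL2 mT z.1)%:E) =
         (fun z => ((u \_ (T `*` S)) z)%:E).
  apply/funext => z; congr (_%:E); rewrite !indL2E patchE in_setX.
  by case: (z.1 \in T); case: (z.2 \in S); rewrite /= ?mulr1 ?mulr0.
rewrite E fineK // -E; apply: integrable_fin_num => //.
exact: (form_integrable hu (indL2 mS) (indL2 mT)).
Qed.

Lemma kernel_indic_L1 S (mS : measurable S) :
  \int[mu]_x `|K (indL2 mS) x| <= 2 * kappa.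
Proof.
have [T1 [T2 [m1 [m2 ->]]]] := abs_integral_split (K (indL2 mS)).
have := ip_kernel_indic mS m1; have := ip_kernel_indic mS m2.
by rewrite !ler_norml => /andP[? ?] /andP[? ?]; lra.
Qed.

(** By duality: pairing [K b] with an indicator moves [K] onto the indicator, where the L^1 norm is
    at most [2 * kappa]. The sign sets of [K b] account for the second factor 2. *)
Lemma kernel_L1_bounded (b : L2) s : (forall x, `|b x| <= s) -> 0 <= s ->
  \int[mu]_x `|K b x| <= 4 * kappa * s.
Proof.
move=> bs s0; have [S1 [S2 [m1 [m2 ->]]]] := abs_integral_split (K b).
have key S (mS : measurable S) : `|ip (K b) (indL2 mS)| <= s * (2 * kappa).
  rewrite (kernel_op_sym hu); apply: le_trans (ip_bounded _ bs) _.
  by rewrite ler_wpM2l // kernel_indic_L1.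
have := key _ m1; have := key _ m2.
by rewrite !ler_norml => /andP[? ?] /andP[? ?]; lra.
Qed.

Lemma kernel_op_bounded (f : L2) x : `|K f x| <= Num.sqrt (nsq f).
Proof.
rewrite -ler_sqr ?nnegrE ?sqrtr_ge0 // sqr_sqrtr ?nsq_ge0 // real_normK ?num_real //.
apply: le_trans (cauchy_schwarz ip _ _) _.
by rewrite -[leRHS]mul1r ler_wpM2r ?nsq_ge0 // nsq_sect.
Qed.

Lemma kernel_nsq_le (f : L2) : nsq (K f) <= nsq f.
Proof.
apply: nsq_le_bound => x; rewrite -(real_normK (num_real _)).
rewrite -[leRHS]sqr_sqrtr ?nsq_ge0 // ler_sqr ?nnegrE ?sqrtr_ge0 //.
exact: kernel_op_bounded.
Qed.

(* With b = K f and c = K b, symmetry gives |b|_2^4 <= |f|_2^2 |c|_2^2, and c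
   is small in L^2 because it is bounded and small in L^1. *)
Lemma kernel_nsq_cut (f : L2) : nsq (K f) ^+ 2 <= 4 * kappa * nsq f ^+ 2.
Proof.
pose s := Num.sqrt (nsq f); have s0 : 0 <= s by exact: sqrtr_ge0.
have s2 : s ^+ 2 = nsq f by rewrite sqr_sqrtr ?nsq_ge0.
have bs x : `|K f x| <= s by exact: kernel_op_bounded.
have cs x : `|K (K f) x| <= s.
  apply: le_trans (kernel_op_bounded _ _) _.
  by rewrite ler_sqrt ?nsq_ge0 // kernel_nsq_le.
have h1 : nsq (K f) ^+ 2 <= nsq f * nsq (K (K f)).
  by rewrite [nsq (K f)](kernel_op_sym hu); exact: cauchy_schwarz.
have h2 : nsq (K (K f)) <= s * (4 * kappa * s).
  apply: le_trans (ler_norm _) _; apply: le_trans (ip_bounded _ cs) _.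
  by rewrite ler_wpM2l //; exact: kernel_L1_bounded.
apply: le_trans h1 _; apply: le_trans (ler_wpM2l (nsq_ge0 _ _) h2) _.
by rewrite -s2 le_eqVlt; apply/orP; left; apply/eqP; ring.
Qed.

(** The power 4 arises because [kernel_nsq_cut] bounds the square of [nsq (K f)]: one root gives
    [nsq (K f) <= eps^2 nsq f], and Cauchy-Schwarz takes the second. *)
Lemma kernel_form_cut (f : L2) eps : 0 < eps -> 4 * kappa <= eps ^+ 4 ->
  `|ip (K f) f| <= eps * nsq f.
Proof.
move=> e0 he; have f0 := nsq_ge0 ip f.
rewrite -ler_sqr ?nnegrE ?mulr_ge0 ?(ltW e0) // real_normK ?num_real //.
apply: le_trans (cauchy_schwarz ip _ _) _.
have h : nsq (K f) <= eps ^+ 2 * nsq f.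
  rewrite -ler_sqr; [|by rewrite nnegrE nsq_ge0|by rewrite nnegrE mulr_ge0 ?sqr_ge0].
  apply: le_trans (kernel_nsq_cut f) _.
  by rewrite exprMn -exprM ler_wpM2r ?sqr_ge0.
by have := ler_wpM2r f0 h; rewrite exprMn (expr2 (nsq f)) mulrA.
Qed.

End Kernel.
End CutNorm.

(** * Complex L^2 as a real Hilbert space *)

Section ComplexL2.
Context {R : realType} {d : measure_display} {X : measurableType d}.
Variable mu : probability X R.
Local Notation L2 := (realL2 mu).
Local Notation ip2 := (innerL2 mu).

Definition cL2 := (L2 * L2)%type.
HB.instance Definition _ := GRing.Lmodule.on cL2.
Implicit Types v w : cL2.

Definition ipV v w : R := ip2 v.1 w.1 + ip2 v.2 w.2.

Lemma ipVC v w : ipV v w = ipV w v.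
Proof. by congr (_ + _); exact: ipC. Qed.

Lemma ipVDl v w z : ipV (v + w) z = ipV v z + ipV w z.
Proof. by rewrite /ipV /= !ipL2Dl addrACA. Qed.

Lemma ipVZl a v w : ipV (a *: v) w = a * ipV v w.
Proof. by rewrite /ipV /= !ipL2Zl mulrDr. Qed.

Lemma ipV_ge0 v : 0 <= ipV v v.
Proof. by rewrite addr_ge0 //; exact: ip_ge0. Qed.

Definition innerV : semi_inner cL2 := SemiInner ipVC ipVDl ipVZl ipV_ge0.
Local Notation nsqV := (nsq innerV).

Lemma nsqVE v : nsqV v = nsq ip2 v.1 + nsq ip2 v.2.
Proof. by []. Qed.

Lemma cL2_complete : complete innerV.
Proof.
move=> u hu.
have [|x1 h1] := @realL2_complete _ _ _ mu (fun n => (u n).1).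
  move=> eps /hu[N hN]; exists N => m n Nm Nn; apply: le_lt_trans (hN m n Nm Nn).
  by rewrite nsqVE lerDl nsq_ge0.
have [|x2 h2] := @realL2_complete _ _ _ mu (fun n => (u n).2).
  move=> eps /hu[N hN]; exists N => m n Nm Nn; apply: le_lt_trans (hN m n Nm Nn).
  by rewrite nsqVE lerDr nsq_ge0.
exists (x1, x2) => eps eps0; have e2 : 0 < eps / 2 by lra.
have [N1 hN1] := h1 _ e2; have [N2 hN2] := h2 _ e2.
exists (maxn N1 N2) => n; rewrite geq_max => /andP[n1 n2]; rewrite nsqVE.
have a1 : nsq ip2 (u n - (x1, x2)).1 < eps / 2 by exact: hN1.
have a2 : nsq ip2 (u n - (x1, x2)).2 < eps / 2 by exact: hN2.
by lra.
Qed.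

(** Multiplication by the imaginary unit. *)
Definition J v : cL2 := (- v.2, v.1).

Lemma ipVJ v w : innerV (J v) (J w) = innerV v w.
Proof.
rewrite -[LHS]/(ip2 (- v.2) (- w.2) + ip2 v.1 w.1).
by rewrite ipNl ipNr opprK addrC.
Qed.

Lemma ipVJl v w : innerV (J v) w = - innerV v (J w).
Proof.
rewrite -[LHS]/(ip2 (- v.2) w.1 + ip2 v.1 w.2).
rewrite -[innerV v (J w)]/(ip2 v.1 (- w.2) + ip2 v.2 w.1).
by rewrite ipNl ipNr opprD opprK addrC.
Qed.

Definition toF v : X -> R[i] := fun x => Complex (v.1 x) (v.2 x).

Lemma toFD v w : toF (v + w) = toF v \+ toF w. Proof. by []. Qed.
Lemma toFB v w : toF (v - w) = toF v \- toF w. Proof. by []. Qed.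

Lemma toF_scale (a b : R) v x : toF (a *: v + b *: J v) x = Complex a b * toF v x.
Proof.
rewrite -[LHS]/(Complex (a * v.1 x + b * - v.2 x) (a * v.2 x + b * v.1 x)).
by rewrite -[RHS]/(Complex (a * v.1 x - b * v.2 x) (a * v.2 x + b * v.1 x)) mulrN.
Qed.

Lemma toF_sum (I : Type) (s : seq I) (F : I -> cL2) x :
  toF (\sum_(i <- s) F i) x = \sum_(i <- s) toF (F i) x.
Proof. by elim/big_ind2: _ => [//|v a w b <- <-|//]; rewrite toFD. Qed.

(** The inner product is conjugate-linear in its second argument, so [Im <v, w> = Re <v, i w>]. *)
Lemma inner_toF v w : inner mu (toF v) (toF w) = Complex (innerV v w) (innerV v (J w)).
Proof.
rewrite /inner /cintegral /= /ipV /=; congr Complex.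
  rewrite /= /ipL2 -RintegralD //; try exact: L2_mul_integrable.
  by apply: eq_Rintegral => x _; rewrite /=; ring.
by rewrite /= /ipL2 -RintegralD //; exact: L2_mul_integrable.
Qed.

Arguments ip : simpl never.

Lemma integral_sq v : (\int[mu]_x (v.1 x ^+ 2 + v.2 x ^+ 2)%:E = (nsqV v)%:E)%E.
Proof.
rewrite nsqVE (EFinD (nsq ip2 v.1)) !nsqL2E -ge0_integralD //.
- by move=> x _; rewrite lee_fin sqr_ge0.
- by apply/measurable_EFinP; apply: measurable_funX; exact: L2_measurable.
- by move=> x _; rewrite lee_fin sqr_ge0.
- by apply/measurable_EFinP; apply: measurable_funX; exact: L2_measurable.
Qed.

Lemma nsqV_eq0 v : nsqV v = 0 <-> {ae mu, forall x, toF v x = 0}.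
Proof.
pose F x : \bar R := (v.1 x ^+ 2 + v.2 x ^+ 2)%:E.
have mF : measurable_fun setT F.
  by apply/measurable_EFinP; apply: measurable_funD; apply: measurable_funX; exact: L2_measurable.
have Fabs : (\int[mu]_x `|F x| = (nsqV v)%:E)%E.
  rewrite -integral_sq; apply: eq_integral => x _.
  by rewrite gee0_abs // lee_fin addr_ge0 ?sqr_ge0.
have FE x : F x = 0%E <-> toF v x = 0.
  split=> [[]|[a b]]; last by rewrite /F a b expr0n /= addr0.
  by move/eqP; rewrite paddr_eq0 ?sqr_ge0 // !sqrf_eq0 => /andP[/eqP a /eqP b]; rewrite /toF a b.
have := ae_eq_integral_abs mu measurableT mF; rewrite Fabs => h.
split=> [v0|ae0].
  have /h : (nsqV v)%:E = 0%E by rewrite v0.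
  by apply: filterS => x /(_ I) /FE.
apply: EFin_inj; apply/h; move: ae0; apply: filterS => x xv _.
exact/FE.
Qed.

Lemma normc_toF v x : ComplexField.Normc.normc (toF v x) ^+ 2 = v.1 x ^+ 2 + v.2 x ^+ 2.
Proof. by rewrite /= sqr_sqrtr // addr_ge0 ?sqr_ge0. Qed.

Lemma L2normE (xi : X -> R[i]) :
  L2norm mu xi = ((\int[mu]_x (ComplexField.Normc.normc (xi x) ^+ 2)%:E) `^ 2^-1)%E.
Proof.
rewrite /L2norm unlock; congr (_ `^ _)%E; apply: eq_integral => x _.
by rewrite /= powR_mulrn // real_normK // num_real.
Qed.

Lemma L2norm_toF v : L2norm mu (toF v) = (Num.sqrt (nsqV v))%:E.
Proof.
rewrite L2normE; under eq_integral do rewrite normc_toF.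
by rewrite integral_sq poweR_EFin powR12_sqrt ?nsq_ge0.
Qed.

Lemma sqr_L2norm_toF v : (L2norm mu (toF v) ^+ 2 = (nsqV v)%:E)%E.
Proof. by rewrite L2norm_toF -EFin_expe sqr_sqrtr ?nsq_ge0. Qed.

Lemma inL2_toF v : inL2 mu (toF v).
Proof.
split; [exact: (L2_measurable v.1)|exact: (L2_measurable v.2)|].
by rewrite L2norm_toF ltry.
Qed.

Lemma inL2_ex xi : inL2 mu xi -> exists v, xi = toF v.
Proof.
case=> m1 m2; rewrite L2normE => h.
have {h} fin : (\int[mu]_x (ComplexField.Normc.normc (xi x) ^+ 2)%:E < +oo)%E.
  exact: (lty_poweRy (r := 2^-1)).
pose a x := complex.Re (xi x); pose b x := complex.Im (xi x).
have nE x : ComplexField.Normc.normc (xi x) ^+ 2 = a x ^+ 2 + b x ^+ 2.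
  by rewrite /a /b; case: (xi x) => r s /=; rewrite sqr_sqrtr // addr_ge0 ?sqr_ge0.
have mn : measurable_fun setT (fun x => (ComplexField.Normc.normc (xi x) ^+ 2)%:E).
  apply/measurable_EFinP; under eq_fun do rewrite nE.
  by apply: measurable_funD; apply: measurable_funX.
have in_ (c : X -> R) : measurable_fun setT c ->
    (forall x, c x ^+ 2 <= ComplexField.Normc.normc (xi x) ^+ 2) -> c \in Lfun mu 2%:E.
  move=> mc hc; apply/Lfun2P; split=> //; apply: le_lt_trans fin.
  apply: ge0_le_integral => //.
  - by move=> x _; rewrite lee_fin sqr_ge0.
  - by apply/measurable_EFinP; exact: measurable_funX.
  - by move=> x _; rewrite lee_fin.
have ain : a \in Lfun mu 2%:E by apply: in_ => // x; rewrite nE lerDl sqr_ge0.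
have bin : b \in Lfun mu 2%:E by apply: in_ => // x; rewrite nE lerDr sqr_ge0.
exists (mkL2 ain, mkL2 bin); apply/funext => x.
by rewrite -[RHS]/(Complex (a x) (b x)) /a /b; case: (xi x).
Qed.

Section Operator.
Context (w : X * X -> R) (hw : sym_kernel mu w).

Definition opV v : cL2 := (kernel_op hw v.1, kernel_op hw v.2).

Lemma opV_linear : linear opV.
Proof. by move=> a v z; rewrite /opV /= !kernel_op_linear. Qed.

Lemma opV_sym : symmetric innerV opV.
Proof.
move=> v z; rewrite -[LHS]/(ip2 (kernel_op hw v.1) z.1 + ip2 (kernel_op hw v.2) z.2).
by rewrite !(kernel_op_sym hw).
Qed.

(* Bessel's inequality for the sections w(x, .), once as real parts and once
   as imaginary parts. *)
Lemma opV_hs : hilbert_schmidt innerV opV 2.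
Proof.
move=> m e oe; under eq_bigr do rewrite nsqVE.
rewrite big_split /= -[2]/(1 + 1); apply: lerD; apply: kernel_op_sum_nsq => x.
  pose z : cL2 := (sect hw x, 0).
  have E i : innerV z (e i) = ip2 (sect hw x) (e i).1.
    by rewrite -[LHS]/(ip2 (sect hw x) (e i).1 + ip2 0 (e i).2) ip0l addr0.
  have zE : nsqV z = nsq ip2 (sect hw x) by rewrite nsqVE nsq0 addr0.
  apply: le_trans (nsq_sect hw x); rewrite -zE; apply: le_trans (bessel oe z).
  by apply: ler_sum => i _; rewrite E.
pose z : cL2 := (0, sect hw x).
have E i : innerV z (e i) = ip2 (sect hw x) (e i).2.
  by rewrite -[LHS]/(ip2 0 (e i).1 + ip2 (sect hw x) (e i).2) ip0l add0r.
have zE : nsqV z = nsq ip2 (sect hw x) by rewrite nsqVE nsq0 add0r.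
apply: le_trans (nsq_sect hw x); rewrite -zE; apply: le_trans (bessel oe z).
by apply: ler_sum => i _; rewrite E.
Qed.

Lemma opV_J v : opV (J v) = J (opV v).
Proof.
have KN f : kernel_op hw (- f) = - kernel_op hw f.
  apply/LfuneqP => x; rewrite L2_oppE !kernel_opE; exact: ipNr.
by rewrite /opV /J /= KN.
Qed.

Lemma graphon_op_toF v : graphon_op mu w (toF v) = toF (opV v).
Proof.
apply/funext => x; rewrite /graphon_op /cintegral.
rewrite -[RHS]/(Complex (ipL2 (sect hw x) v.1) (ipL2 (sect hw x) v.2)) /ipL2.
by congr Complex; apply: eq_Rintegral => y _; rewrite /=; ring.
Qed.

Lemma in_eigenspace_toF l v :
  in_eigenspace mu w l (toF v) <-> nsqV (opV v - l *: v) = 0.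
Proof.
rewrite /in_eigenspace graphon_op_toF nsqV_eq0.
have E x : toF (opV v - l *: v) x = toF (opV v) x - real_complex R l * toF v x.
  rewrite toFB /=; congr (_ - _).
  by have := toF_scale l 0 v x; rewrite scale0r addr0.
split=> [[_]|h]; last split; first 1 last.
- exact: inL2_toF.
- by apply: filterS h => x; rewrite E => /eqP; rewrite subr_eq0 => /eqP.
- by apply: filterS => x h; rewrite E h subrr.
Qed.

Section System.
Context (lam : int -> R) (phi : int -> X -> R[i]) (hphi : eigensystem mu w lam phi).

(** Complex orthonormality contains two real statements, one with [psi j] and one with [J (psi j)],
    which together make the pairs real orthonormal. A complex combination of the [phi i] is a real
    combination of these pairs, which transfers totality. *)
Lemma eigensystem_spectral : exists psi : int -> cL2,
  (forall i, nonzero_indices lam i -> phi i = toF (psi i)) /\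
  spectral_system innerV opV lam (fun p => if p.2 then J (psi p.1) else psi p.1).
Proof.
have [ho [hin hon] he ht] := hphi.
(* At padding indices [phi i] need not be square-integrable; the default is 0. *)
have /choice[psi hpsi] i : exists v, nonzero_indices lam i -> phi i = toF v.
  have [nz|nz] := pselect (nonzero_indices lam i); last by exists 0.
  by have [v] := inL2_ex (hin i nz); exists v.
exists psi; split=> //.
have on i j : nonzero_indices lam i -> nonzero_indices lam j ->
    innerV (psi i) (psi j) = (i == j)%:R /\ innerV (psi i) (J (psi j)) = 0.
  move=> ni nj; have := hon i j ni nj; rewrite !hpsi // inner_toF.
  by case: (i == j) => h; split; [exact: (congr1 (@complex.Re R) h)|exact: (congr1 (@complex.Im R) h)
    |exact: (congr1 (@complex.Re R) h)|exact: (congr1 (@complex.Im R) h)].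
have eig i : nonzero_indices lam i -> nsqV (opV (psi i) - lam i *: psi i) = 0.
  by move=> ni; apply/in_eigenspace_toF; rewrite -hpsi //; exact: he.
split.
- exact: opV_linear.
- exact: opV_sym.
- by exists 2; exact: opV_hs.
- exact: ho.
- move=> [i b] [j c] /= ni nj; have [h1 h2] := on i j ni nj.
  rewrite xpair_eqE; case: b; case: c; rewrite /= ?ipVJ ?ipVJl ?h1 ?h2 ?oppr0 ?andbT ?andbF //.
- move=> [i [|]] /= ni; last exact: eig.
  have -> : opV (J (psi i)) - lam i *: J (psi i) = J (opV (psi i) - lam i *: psi i).
    rewrite opV_J; congr pair.
    rewrite -[LHS]/(- kernel_op hw (psi i).2 - lam i *: - (psi i).2).
    by rewrite -[RHS]/(- (kernel_op hw (psi i).2 - lam i *: (psi i).2)) scalerN opprD.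
  by rewrite /nsq ipVJ; exact: eig.
- move=> l g l0 gl hg.
  have [s [a [hs ga]]] := ht l (toF g) l0 ((in_eigenspace_toF l g).2 gl).
  (* [g] agrees with [g'] up to a null vector and is orthogonal to it, hence is null. *)
  pose g' := \sum_(i <- s) (complex.Re (a i) *: psi i + complex.Im (a i) *: J (psi i)).
  have nzs i : i \in s -> nonzero_indices lam i /\ lam i = l.
    by move=> /hs[i0 il]; split=> //; split; rewrite ?il.
  have gg' : nsqV (g - g') = 0.
    apply/nsqV_eq0; apply: filterS ga => x gx; rewrite toFB /= gx /g' toF_sum.
    apply/eqP; rewrite subr_eq0; apply/eqP; apply: eq_big_seq => i /nzs[ni _].
    by rewrite toF_scale -hpsi //; case: (a i).
  have ig' : innerV g g' = 0.
    rewrite ip_sumr big_seq big1 // => i /nzs[ni il].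
    by rewrite ipDr !ipZr (hg (i, false)) // (hg (i, true)) // !mulr0 addr0.
  have : innerV g (g - g') = 0 by rewrite ipC; exact: ip_nsq0.
  by rewrite ipBr ig' subr0.
Qed.

End System.
End Operator.

(** The complex coefficient of [phi i] has real part [<v, psi i>] and imaginary part
    [<v, J (psi i)>], so one complex term is the sum of the two real terms of the pair. *)
Lemma spectral_proj_toF lam (phi : int -> X -> R[i]) (psi : int -> cL2) (s : seq int) v :
  (forall i, nonzero_indices lam i -> phi i = toF (psi i)) -> uniq s -> 0 \notin s ->
  spectral_proj mu lam phi [set` s] (toF v) =
  toF (orth_proj innerV (idx lam s) (fun p => if p.2 then J (psi p.1) else psi p.1) v).
Proof.
move=> hpsi us s0; apply/funext => x; rewrite /spectral_proj.
rewrite (@fsbig_fwiden _ _ _ _ [seq i <- s | lam i != 0]) /=; last 3 first.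
- by move=> i /= [si [i0 li]]; rewrite mem_filter li.
- by rewrite filter_uniq.
- move=> i /= []; rewrite mem_filter => /andP[li si] ni; exfalso; apply: ni.
  by split=> //; split=> //; apply: contraNneq s0 => <-.
rewrite /orth_proj /idx big_allpairs_dep /= toF_sum.
apply: eq_big_seq => i; rewrite mem_filter => /andP[li si].
have i0 : i != 0 by apply: contraNneq s0 => <-.
by rewrite !big_cons big_nil addr0 /= toF_scale hpsi // inner_toF.
Qed.

End ComplexL2.

(** * Translation between extended-real norms and the abstract modes of convergence *)

Section NormConvergence.
Context {R : realType}.

Lemma cvge0P (h : nat -> \bar R) : (forall n, (0 <= h n)%E) ->
  h n @[n --> \oo] --> 0%E <->
  forall eps, 0 < eps -> exists N, forall n, (N <= n)%N -> (h n <= eps%:E)%E.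
Proof.
move=> h0; split=> [/fine_cvgP[[N1 _ fin] /cvgr0Pnorm_le hc] eps eps0|hc].
  have [N2 _ hN] := hc _ eps0.
  exists (maxn N1 N2) => n; rewrite geq_max => /andP[n1 n2].
  rewrite -(fineK (fin n n1)) lee_fin; apply: le_trans (ler_norm _) _.
  exact: hN n n2.
have fin n : (h n <= 1%:E)%E -> h n \is a fin_num.
  by move=> h1; rewrite ge0_fin_numE //; apply: le_lt_trans h1 _; rewrite ltry.
apply/fine_cvgP; split.
  by have [N hN] := hc 1 ltr01; exists N => // n /hN /fin.
apply/cvgr0Pnorm_le => eps eps0.
have e0 : 0 < Num.min eps 1 by rewrite lt_min eps0 ltr01.
have [N hN] := hc _ e0; exists N => // n /= Nn.
have hn := hN n Nn.
have hf : h n \is a fin_num.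
  by apply: fin; apply: le_trans hn _; rewrite lee_fin ge_min lexx orbT.
rewrite ger0_norm ?fine_ge0 // -lee_fin fineK //; apply: le_trans hn _.
by rewrite lee_fin ge_min lexx.
Qed.

Context {d : measure_display} {X : measurableType d} (mu : probability X R).
Local Notation innerV := (innerV mu).
Local Notation toF := (@toF R d X mu).

Lemma cut_norm_ge (u : X * X -> R) S T : measurable S -> measurable T ->
  ((`|\int[(mu \x mu)%E]_(z in S `*` T) u z|%R)%:E <= cut_norm mu u)%E.
Proof. by move=> mS mT; apply: ereal_sup_ubound; exists S, T. Qed.

Lemma cut_norm_ge0 (u : X * X -> R) : (0 <= cut_norm mu u)%E.
Proof.
apply: le_trans (cut_norm_ge u measurable0 measurable0).
by rewrite lee_fin.
Qed.

Lemma kernel_opB w1 w2 (h1 : graphon mu w1) (h2 : graphon mu w2) f :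
  kernel_op (graphonB_kernel h1 h2) f =
  kernel_op (graphon_kernel h1) f - kernel_op (graphon_kernel h2) f.
Proof.
apply/LfuneqP => x; rewrite L2_addE L2_oppE !kernel_opE -ipBl.
by congr (ip _ _ _).
Qed.

Lemma graphon_form_tends w wn (hw : graphon mu w) (hwn : forall n, graphon mu (wn n)) :
  cut_norm mu (wn n \- w) @[n --> \oo] --> 0%E ->
  form_tends innerV (fun n => opV (graphon_kernel (hwn n))) (opV (graphon_kernel hw)).
Proof.
move/(cvge0P (fun n => cut_norm_ge0 _)) => hc eps eps0.
have e4 : 0 < eps ^+ 4 / 4 by rewrite divr_gt0 // exprn_gt0.
have [N hN] := hc _ e4; exists N => n Nn x.
have cut S T : measurable S -> measurable T ->
    `|\int[(mu \x mu)%E]_(z in S `*` T) (wn n \- w) z| <= eps ^+ 4 / 4.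
  by move=> mS mT; rewrite -lee_fin; apply: le_trans (hN n Nn); exact: cut_norm_ge.
have kf f := kernel_form_cut (graphonB_kernel (hwn n) hw) cut f eps0.
have e44 : 4 * (eps ^+ 4 / 4) <= eps ^+ 4 by lra.
have := kf x.1 e44; have := kf x.2 e44; rewrite !kernel_opB !ipBl => k2 k1.
have opE u (hu : sym_kernel mu u) : innerV (opV hu x) x =
    innerL2 mu (kernel_op hu x.1) x.1 + innerL2 mu (kernel_op hu x.2) x.2 by [].
rewrite !opE.
rewrite nsqVE; move: k1 k2; rewrite !ler_norml => /andP[? ?] /andP[? ?].
by apply/andP; split; lra.
Qed.

Lemma L2norm_tends (v : nat -> cL2 mu) v0 :
  (L2norm mu (toF (v n) \- toF v0) @[n --> \oo] --> 0%E) <-> tends innerV v v0.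
Proof.
have E n : L2norm mu (toF (v n) \- toF v0) = (Num.sqrt (nsq innerV (v n - v0)))%:E.
  by rewrite -toFB L2norm_toF.
rewrite cvge0P; last by move=> n; rewrite E lee_fin sqrtr_ge0.
split=> h eps eps0.
  have e0 : 0 < Num.sqrt (eps / 2) by rewrite sqrtr_gt0; lra.
  have [N hN] := h _ e0; exists N => n Nn; have := hN n Nn.
  by rewrite E lee_fin ler_sqrt; lra.
have e0 : 0 < eps ^+ 2 by rewrite exprn_gt0.
have [N hN] := h _ e0; exists N => n Nn; rewrite E lee_fin.
rewrite -(ger0_norm (ltW eps0)) -sqrtr_sqr ler_sqrt ?sqr_ge0 //; exact/ltW/hN.
Qed.

(** A complex orthonormal family, read in the real space, is orthonormal there by the real parts of
    its inner products, so the uniform bound over real families covers the supremum in [hs_norm].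
    The bound is requested at [eps^2] because [hs_norm] takes a square root. *)
Lemma hs_norm_tends (An : nat -> (X -> R[i]) -> X -> R[i]) A (Bn : nat -> cL2 mu -> cL2 mu) B :
  (forall n v, An n (toF v) = toF (Bn n v)) -> (forall v, A (toF v) = toF (B v)) ->
  hs_tends innerV Bn B ->
  hs_norm mu (fun xi => An n xi \- A xi) @[n --> \oo] --> 0%E.
Proof.
move=> hAn hA hB; apply/cvge0P => [n|eps eps0]; first by rewrite sqrte_ge0.
have e2 : 0 < eps ^+ 2 by rewrite exprn_gt0.
have [N hN] := hB _ e2; exists N => n Nn.
have -> : eps%:E = sqrte (eps ^+ 2)%:E by rewrite /= sqrtr_sqr ger0_norm // ltW.
rewrite /hs_norm lee_sqrt ?lee_fin ?sqr_ge0 //.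
apply: ge_ereal_sup => _ [m [e [[ein eon] ->]]].
have /choice[v hv] k : exists v, (k < m)%N -> e k = toF v.
  have [km|km] := ltnP k m; last by exists 0.
  by have [v] := inL2_ex (ein k km); exists v.
rewrite -(big_mkord xpredT (fun k => (L2norm mu (An n (e k) \- A (e k))%R ^+ 2)%E)).
rewrite /index_iota subn0.
have -> : (\sum_(k <- iota 0 m) L2norm mu (An n (e k) \- A (e k))%R ^+ 2)%E =
    (\sum_(k <- iota 0 m) nsq innerV (Bn n (v k) - B (v k)))%:E.
  rewrite -sumEFin; apply: eq_big_seq => k; rewrite mem_iota add0n => /andP[_ km].
  by rewrite hv // hAn hA -toFB sqr_L2norm_toF.
rewrite lee_fin; apply: hN => //; split=> [|i j]; first exact: iota_uniq.
rewrite !mem_iota !add0n => /andP[_ im] /andP[_ jm].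
have := eon i j im jm; rewrite !hv // inner_toF.
by case: (i == j) => h; exact: (congr1 (@complex.Re R) h).
Qed.

End NormConvergence.

(** * Spectral projections of convergent graphon signals *)

Unset Implicit Arguments.
Theorem theorem3p7 (R : realType) (d : measure_display) (X : measurableType d)
  (mu : probability X R)
  (hX : standard_probability mu) (hinf : infinite_set [set: X])
  (w : X * X -> R) (f : X -> R[i])
  (wn : nat -> X * X -> R) (fn : nat -> X -> R[i])
  (hwf : graphon_signal mu w f)
  (hwfn : forall n, graphon_signal mu (wn n) (fn n))
  (hcvg : cvg_in_norm mu wn fn w f)
  (lam : int -> R) (phi : int -> X -> R[i])
  (hlam : eigensystem mu w lam phi)
  (lamn : nat -> int -> R) (phin : nat -> int -> X -> R[i])
  (hlamn : forall n, eigensystem mu (wn n) (lamn n) (phin n))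
  (m : int -> R) (hm : distinct_eigenvalues mu w m) :
  let I (j : int) := eigen_indices lam (m j) in
  let P (j : int) := spectral_proj mu lam phi (I j) in
  let Pn (n : nat) (j : int) := spectral_proj mu (lamn n) (phin n) (I j) in
  [/\ (forall j : int, j != 0 -> m j != 0 ->
        hs_norm mu (fun xi => Pn n j xi \- P j xi) @[n --> \oo] --> 0%E),
      (forall j : int, j != 0 -> m j != 0 ->
        L2norm mu (Pn n j (fn n) \- P j f) @[n --> \oo] --> 0%E) &
      (is_orth_proj mu (null_space mu w) f (fun _ => 0) ->
        (\esum_(j in [set j : int | (j != 0)%R])
          L2norm mu (Pn n j (fn n) \- P j f)%R ^+ 2)%E @[n --> \oo] --> 0%E)].
Proof.
move=> I P Pn.
have hwn n : graphon mu (wn n) := (hwfn n).1.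
have hw : graphon mu w := hwf.1.
have [psi [hpsi sys]] := eigensystem_spectral (graphon_kernel hw) hlam.
have /choice[psin hsysn] n := eigensystem_spectral (graphon_kernel (hwn n)) (hlamn n).
have hpsin n := (hsysn n).1; have sysn n := (hsysn n).2.
have Vc : complete (innerV mu) by exact: cL2_complete.
have hT := graphon_form_tends hw hwn hcvg.1.
have [vf fE] := inL2_ex hwf.2.
have /choice[vfn fnE] n := inL2_ex (hwfn n).2.
have vtends : tends (innerV mu) vfn vf.
  by apply/L2norm_tends; under eq_fun do rewrite -fnE -fE; exact: hcvg.2.
have [_ lam_on lam_eig lam_total] := hlam.
have [_ m_inj m_eig m_total] := hm.
pose rpsi (p : int * bool) := if p.2 then J (psi p.1) else psi p.1.
pose rpsin n (p : int * bool) := if p.2 then J (psin n p.1) else psin n p.1.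
(* The lists are defined for every [j], and empty when [j = 0] or [m j = 0], so that disjointness
   and convergence hold over all of [int], as [block_sum_tends] demands. *)
have /choice[s hs] j : exists s : seq int, [/\ uniq s,
    (forall i, i \in s <-> [/\ j != 0, m j != 0, i != 0 & lam i = m j]) &
    hs_tends (innerV mu) (fun n => orth_proj (innerV mu) (idx (lamn n) s) (rpsin n))
             (orth_proj (innerV mu) (idx lam s) rpsi)].
  have triv : ~ (j != 0 /\ m j != 0) -> exists s : seq int, [/\ uniq s,
      (forall i, i \in s <-> [/\ j != 0, m j != 0, i != 0 & lam i = m j]) &
      hs_tends (innerV mu) (fun n => orth_proj (innerV mu) (idx (lamn n) s) (rpsin n))
             (orth_proj (innerV mu) (idx lam s) rpsi)].
    move=> nj; exists [::]; split=> // [i|eps eps0]; first by split=> // -[]; tauto.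
    exists 0%N => n _ k r _; rewrite big1 ?ltW // => i _.
    by rewrite /orth_proj !big_nil subrr nsq0.
  have [[j0 mj]|] := pselect (j != 0 /\ m j != 0); last exact: triv.
  have exi : exists i, i != 0 /\ lam i = m j.
    (* An eigenvector for [m j] is not null, so its expansion in the [phi i] has a term, whose index
       satisfies [lam i = m j]. *)
    have [xi [xi_eig xi_nz]] := m_eig j (conj j0 mj).
    have [[|i t] [a [ht hxi]]] := lam_total _ _ mj xi_eig.
      by exfalso; apply: xi_nz; move: hxi; apply: filterS => x ->; rewrite big_nil.
    by exists i; apply: ht; exact: mem_head.
  have [t [ut ht tt]] := eigenvalue_block Vc sys sysn hT mj exi.
  exists t; split=> // i; split=> [/ht[]|[_ _ i0 li]]; first by split.
  by apply/ht.
have s_uniq j : uniq (s j) by case: (hs j).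
have s_mem j i := let: And3 _ h _ := hs j in h i.
have s0 j : 0 \notin s j by apply/negP => /s_mem[]; rewrite eqxx.
have s_disj i j k : k \in s i -> k \in s j -> i = j.
  move=> /s_mem[i0 mi _ li] /s_mem[j0 mj _ lj].
  exact: m_inj (conj i0 mi) (conj j0 mj) (etrans (esym li) lj).
have IE j : j != 0 -> I j = [set` s j].
  move=> j0; apply/seteqP; split=> i /=.
    by move=> [[i0 li] lij]; apply/s_mem; split=> //; rewrite -lij.
  by move=> /s_mem[_ mj i0 li]; split=> //; split; rewrite ?li.
pose A j := orth_proj (innerV mu) (idx lam (s j)) rpsi.
pose An n j := orth_proj (innerV mu) (idx (lamn n) (s j)) (rpsin n).
have PE j v : j != 0 -> P j (toF v) = toF (A j v).
  by move=> j0; rewrite /P IE //; exact: spectral_proj_toF.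
have PnE n j v : j != 0 -> Pn n j (toF v) = toF (An n j v).
  by move=> j0; rewrite /Pn IE //; exact: (spectral_proj_toF _ (hpsin n)).
have Al j : linear (A j) by exact: proj_linear.
have Anl n j : linear (An n j) by exact: proj_linear.
have Ale j v : nsq (innerV mu) (A j v) <= nsq (innerV mu) v.
  by apply: nsq_proj_le; exact: (onf_idx sys).
have Anle n j v : nsq (innerV mu) (An n j v) <= nsq (innerV mu) v.
  by apply: nsq_proj_le; exact: (onf_idx (sysn n)).
have htends j : hs_tends (innerV mu) (fun n => An n j) (A j) by case: (hs j).
have vA j : tends (innerV mu) (fun n => An n j (vfn n)) (A j vf).
  have Anlj n := Anl n j; have Anlej n := Anle n j.
  apply: (tends_app (An := fun n => An n j) Anlj Anlej vtends).
  exact: (hs_tends_app _ (Al j) Anlj Anlej (Ale j) (htends j)).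
split.
- move=> j j0 _; apply: (hs_norm_tends (Bn := fun n => An n j) (B := A j)) => //.
    by move=> n v; exact: PnE.
  by move=> v; exact: PE.
- move=> j j0 _; have := (L2norm_tends _ _).2 (vA j).
  by under eq_fun do rewrite -PnE // -PE // -fnE -fE.
move=> [_ fperp].
(* A zero projection means that [f] is orthogonal to the null space; the real part of that complex
   orthogonality is what [block_sum_tends] uses. *)
have f0 h : nsq (innerV mu) (opV (graphon_kernel hw) h) = 0 -> innerV mu vf h = 0.
  move=> hh; have hnull : null_space mu w (toF h).
    split; first exact: inL2_toF.
    by rewrite (graphon_op_toF (graphon_kernel hw)); exact: (nsqV_eq0 _).1 hh.
  have := fperp _ hnull.
  have -> : f \- (fun=> 0) = toF vf by rewrite -fE; apply/funext => x; rewrite /= subr0.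
  by rewrite inner_toF => e; exact: (congr1 (@complex.Re R) e).
(* [phi i] has norm 1 and so is not null; hence a nonzero [lam i] is an eigenvalue and equals some
   [m j]. *)
have cover i : i != 0 -> lam i != 0 -> exists j, i \in s j.
  move=> i0 li; have ni : nonzero_indices lam i by split.
  have [|j [j0 mj]] := m_total (lam i) li; last by exists j; apply/s_mem; rewrite mj.
  exists (phi i); split; first exact: lam_eig.
  rewrite hpsi // => /nsqV_eq0 h0.
  have h1 : nsq (innerV mu) (psi i) = ((i, false) == (i, false))%:R.
    exact: (sys_onf sys (p := (i, false)) (q := (i, false)) ni ni).
  by move: h1; rewrite eqxx h0 => /esym /eqP; rewrite oner_eq0.
apply/cvge0P => [n|eps eps0]; first by apply: esum_ge0 => j _; exact: sqre_ge0.
have [N hN] := block_sum_tends Vc s_uniq s0 s_disj sys sysn cover vtends f0 vA eps0.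
(* The infinite sum is a supremum over finite index sets, so the bound uniform in [F] suffices. *)
exists N => n Nn; apply: ge_ereal_sup => _ [F [finF F0] <-].
rewrite fsbig_finite //=.
have sumE (t : seq int) : {in t, forall j, j != 0} ->
    (\sum_(j <- t) L2norm mu (Pn n j (fn n) \- P j f)%R ^+ 2)%E =
    (\sum_(j <- t) nsq (innerV mu) (An n j (vfn n) - A j vf))%:E.
  move=> t0; rewrite -sumEFin; apply: eq_big_seq => j /t0 j0.
  by rewrite fnE fE PnE // PE // -toFB sqr_L2norm_toF.
rewrite sumE; last by move=> j; rewrite in_fset_set // inE => /F0.
by rewrite lee_fin; apply: hN => //; exact: finmap.fset_uniq.
Qed.
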